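(* Let $d\ge2$ and let $\mathcal H\subseteq\mathfrak{sl}_d$ be the Lie subalgebra generated by $H_n=E_{nn}-E_{n+1,n+1}$ ($1\le n\le d-1$), $E_{1n}$ ($2\le n\le d$) and $E_{nd}$ ($1\le n\le d-1$), where $E_{nk}$ are the $d\times d$ matrix units, normed by the Frobenius norm. Let $c_1,\dots,c_{d-1}\in\mathbb C$ and put $$H=\frac12\sum_{s=1}^{d-1}c_sH_s,\qquad\mathsf X=\sum_{s=2}^{d-1}E_{1s}\otimes E_{sd},\qquad F_n=\sum_{m=0}^n\binom nm\,\mathsf X^m\cdot\Bigl((H+m)_{(n-m)\uparrow}\otimes E_{1d}^{\,n-m}\Bigr)$$ for $n\in\mathbb N_0$, as elements of $U(\mathcal H)$ and $U(\mathcal H)\otimes U(\mathcal H)$ respectively, where $Y_{k\uparrow}=\prod_{j=0}^{k-1}(Y+j)$ and $Y_{0\uparrow}=1$; let $F_\hbar=\sum_{n=0}^\infty\frac{\hbar^n}{n!}F_n$. Let $R=1$ and let $\mu\colon V\otimes W\to X$ be a malleable inductive $\mathcal H$-triple. Then both of the following hold. (A) For every $r>0$, $q_V\in\mathrm{cs}(V)$, $q_W\in\mathrm{cs}(W)$ and compact $K\subseteq\mathbb C$ there exist $q_V'\in\mathrm{cs}(V)$, $q_W'\in\mathrm{cs}(W)$ and $t,C>0$ such that $$\bigl(p^{(R)}_{r,q_V}\otimes p^{(R)}_{r,q_W}\bigr)\Bigl(\tfrac{\hbar^n}{n!}F_n\triangleright(v\otimes w)\Bigr)\le C\,p^{(R)}_{tr,q_V'}(v)\,p^{(R)}_{tr,q_W'}(w)$$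 for all $v\in\mathcal E_R(\varrho_V)$, $w\in\mathcal E_R(\varrho_W)$, $\hbar\in K$, $n\in\mathbb N_0$. (B) For every $\alpha\in J_V$, $\beta\in J_W$, $r_1,r_2>0$, $q_\alpha\in\mathrm{cs}(V_\alpha)$, $q_\beta\in\mathrm{cs}(W_\beta)$ and compact $K\subseteq\mathbb C$ there exist $q_\alpha'\in\mathrm{cs}(V_\alpha)$, $q_\beta'\in\mathrm{cs}(W_\beta)$ and $t,C>0$ such that $$\bigl(p^{(R)}_{r,q_\alpha}\otimes p^{(R)}_{r,q_\beta}\bigr)\Bigl(\tfrac{\hbar^n}{n!}F_n\triangleright(v\otimes w)\Bigr)\le C\,p^{(R)}_{tr,q_\alpha'}(v)\,p^{(R)}_{tr,q_\beta'}(w)$$ for all $v\in\mathcal A_{R,r_1}(\varrho_{V,\alpha})$, $w\in\mathcal A_{R,r_2}(\varrho_{W,\beta})$, $r<\frac{2^{-R}}{t}\min\{r_1,r_2\}$, $\hbar\in K$, $n\in\mathbb N_0$.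
   Context: Lie algebras are finite-dimensional and real; $\mathbb B$ is the open unit ball of the Lie algebra $\mathfrak g$ (here $\mathfrak g=\mathcal H$). Locally convex spaces are complex. $\mathrm{cs}(V)$ is the set of continuous seminorms, $L(V)$ the continuous linear endomorphisms. A representation is a Lie algebra morphism $\varrho\colon\mathfrak g\to L(V)$, extended to the (complexified) universal enveloping algebra $U(\mathfrak g)$; $\Xi\triangleright v=\varrho(\Xi)v$. $U(\mathfrak g)\otimes U(\mathfrak g)$ carries the factorwise product and acts factorwise on $V\otimes W$. $p\otimes q$ is the projective tensor product of seminorms. A $\mathfrak g$-triple consists of representations $\varrho_V,\varrho_W,\varrho_X$ on locally convex spaces $V,W,X$ and a linear map $\mu\colon V\otimes W\to X$. It is malleable if $\xi\triangleright\mu(v\otimes w)=\mu((\xi\triangleright v)\otimes w+v\otimes(\xi\triangleright w))$ for all $v,w$, $\xi\in\mathfrak g$. A fully reduced inductive system is a family $(V_\alpha)_{\alpha\in J}$ of locally convex spaces indexed by a directed set with continuous inclusions $V_\alpha\subseteq V_\beta$ for $\alpha\preccurlyeq\beta$; its inductive limit is $\bigcup_\alpha V_\alpha$ with the final locally convex topology. A $\mathfrak g$-triple is inductive if (i) $V,W,X$ are inductive limits of fully reduced systems $(V_\alpha)_{\alpha\in J_V}$, $(W_\beta)_{\beta\in J_W}$, $(X_\gamma)_{\gamma\in J_X}$ of invariant subspaces; (ii) for all $\alpha,\beta$ there is $\gamma$ such that $\mu\colon V_\alpha\otimes W_\beta\to X_\gamma$ is well-defined and continuous (projective topology). The restrictions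 $\varrho_{V,\alpha}$ of $\varrho_V$ to $V_\alpha$ and $\varrho_{W,\beta}$ of $\varrho_W$ to $W_\beta$ act by continuous operators. For a representation $\varrho$ on $V$, $R\ge0$, $q\in\mathrm{cs}(V)$, $r\ge0$: $p^{(R)}_{r,q}(v)=\sum_{n=0}^\infty n!^{R-1}r^n\sup_{\xi_1,\dots,\xi_n\in\mathbb B}q(\xi_1\cdots\xi_n\triangleright v)\in[0,\infty]$. For $r_0>0$, $\mathcal A_{R,r_0}(\varrho)=\{v\in V:p^{(R)}_{r,q}(v)<\infty\ \forall q\in\mathrm{cs}(V),0\le r<r_0\}$ with the topology of these seminorms, and $\mathcal E_R(\varrho)=\bigcap_{r_0>0}\mathcal A_{R,r_0}(\varrho)$ with the topology of all $p^{(R)}_{r,q}$, $r\ge0$. *)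

(* Defs.v *)
From HB Require Import structures.
From mathcomp Require Import all_boot all_order all_algebra.
From mathcomp Require Import generic_quotient complex.
From mathcomp Require Import all_classical all_reals all_analysis.
From mathcomp Require Import ring.

Set Implicit Arguments.
Unset Strict Implicit.
Unset Printing Implicit Defensive.

Import Order.TTheory GRing.Theory Num.Theory.
Import numFieldNormedType.Exports.

Local Open Scope classical_set_scope.
Local Open Scope quotient_scope.
Local Open Scope complex_scope.
Local Open Scope ring_scope.

Section Bilinear.
Variable K : pzRingType.
Implicit Types V W X : lmodType K.

Definition bilin V W X (f : V -> W -> X) :=
  (forall w, linear (f^~ w)) /\ (forall v, linear (f v)).

Lemma linD V X (f : V -> X) : linear f -> forall u v, f (u + v) = f u + f v.
Proof. by move=> h u v; have := h 1 u v; rewrite /= !scale1r. Qed.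

Lemma lin0 V X (f : V -> X) : linear f -> f 0 = 0.
Proof. by move=> h; apply: (addrI (f 0)); rewrite -linD // !addr0. Qed.

Lemma linZ V X (f : V -> X) : linear f -> forall a u, f (a *: u) = a *: f u.
Proof. by move=> h a u; have := h a u 0; rewrite /= !addr0 lin0 // addr0. Qed.

Lemma lin_sum V X (f : V -> X) : linear f ->
  forall I (s : seq I) F, f (\sum_(i <- s) F i) = \sum_(i <- s) f (F i).
Proof.
move=> h I s F; elim: s => [|i s IH]; first by rewrite !big_nil lin0.
by rewrite !big_cons linD // IH.
Qed.

End Bilinear.

Section Tensor.
Variables (K : comPzRingType) (V W : lmodType K).
Implicit Types X : lmodType K.

(* A finite sequence of pairs stands for the formal sum of the v (x) w; two
   formal sums are identified when no bilinear map tells them apart. *)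
Definition teq (s t : seq (V * W)) : bool :=
  `[< forall (X : lmodType K) (f : V -> W -> X), bilin f ->
        \sum_(x <- s) f x.1 x.2 = \sum_(x <- t) f x.1 x.2 >].

Fact teq_refl : reflexive teq.
Proof. by move=> s; apply/asboolP. Qed.

Fact teq_sym : symmetric teq.
Proof.
by move=> s t; apply/asboolP/asboolP => h X f /(h X) ->.
Qed.

Fact teq_trans : transitive teq.
Proof.
move=> t s u /asboolP h /asboolP h'; apply/asboolP => X f bf.
by rewrite (h X f bf) (h' X f bf).
Qed.

Canonical teq_equiv := EquivRel teq teq_refl teq_sym teq_trans.

Definition tensor := {eq_quot teq_equiv}.
HB.instance Definition _ := Choice.on tensor.
HB.instance Definition _ := EqQuotient.on tensor.

Definition tens (v : V) (w : W) : tensor := \pi_tensor [:: (v, w)].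

(* The linear map induced by f, well defined when f is bilinear (tlift_pi). *)
Definition tlift X (f : V -> W -> X) (z : tensor) : X :=
  \sum_(x <- repr z) f x.1 x.2.

Lemma tlift_pi X (f : V -> W -> X) s : bilin f ->
  tlift f (\pi_tensor s) = \sum_(x <- s) f x.1 x.2.
Proof.
move=> bf; rewrite /tlift.
have /eqmodP/asboolP : repr (\pi_tensor s) = s %[mod tensor] by rewrite reprK.
by apply.
Qed.

Lemma tensor_ext (x y : tensor) :
  (forall X (f : V -> W -> X), bilin f -> tlift f x = tlift f y) -> x = y.
Proof.
by move=> h; rewrite -[x]reprK -[y]reprK; apply/eqmodP/asboolP => X f /(h X f).
Qed.

Definition tadd (x y : tensor) : tensor := \pi_tensor (repr x ++ repr y).
Definition tzero : tensor := \pi_tensor [::].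
Definition tscale (a : K) (x : tensor) : tensor :=
  \pi_tensor [seq (a *: p.1, p.2) | p <- repr x].
Definition topp := tscale (-1).

Fact tliftD X (f : V -> W -> X) x y : bilin f ->
  tlift f (tadd x y) = tlift f x + tlift f y.
Proof. by move=> bf; rewrite tlift_pi // big_cat. Qed.

Fact tlift0 X (f : V -> W -> X) : bilin f -> tlift f tzero = 0.
Proof. by move=> bf; rewrite tlift_pi // big_nil. Qed.

Fact tliftZ X (f : V -> W -> X) a x : bilin f ->
  tlift f (tscale a x) = a *: tlift f x.
Proof.
move=> bf; rewrite tlift_pi // big_map scaler_sumr; apply: eq_bigr => p _ /=.
by rewrite (linZ (bf.1 _)).
Qed.

Fact taddA : associative tadd.
Proof. by move=> x y z; apply: tensor_ext => X f bf; rewrite !tliftD ?addrA. Qed.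
Fact taddC : commutative tadd.
Proof. by move=> x y; apply: tensor_ext => X f bf; rewrite !tliftD // addrC. Qed.
Fact tadd0 : left_id tzero tadd.
Proof. by move=> x; apply: tensor_ext => X f bf; rewrite tliftD // tlift0 // add0r. Qed.
Fact taddN : left_inverse tzero topp tadd.
Proof.
move=> x; apply: tensor_ext => X f bf.
by rewrite tliftD // tliftZ // tlift0 // scaleN1r addNr.
Qed.

HB.instance Definition _ := GRing.isZmodule.Build tensor taddA taddC tadd0 taddN.

Fact tscaleA a b x : tscale a (tscale b x) = tscale (a * b) x.
Proof. by apply: tensor_ext => X f bf; rewrite !tliftZ // scalerA. Qed.
Fact tscale1 : left_id 1 tscale.
Proof. by move=> x; apply: tensor_ext => X f bf; rewrite tliftZ // scale1r. Qed.
Fact tscaleDr : right_distributive tscale +%R.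
Proof.
move=> a x y; apply: tensor_ext => X f bf.
by rewrite tliftZ // !tliftD // !tliftZ // scalerDr.
Qed.
Fact tscaleDl x : {morph tscale^~ x : a b / a + b}.
Proof.
move=> a b; apply: tensor_ext => X f bf.
by rewrite tliftZ // tliftD // !tliftZ // scalerDl.
Qed.

HB.instance Definition _ :=
  GRing.Zmodule_isLmodule.Build K tensor tscaleA tscale1 tscaleDr tscaleDl.

Lemma tlift_linear X (f : V -> W -> X) : bilin f -> linear (tlift f).
Proof. by move=> bf a x y; rewrite tliftD // tliftZ. Qed.

Lemma tlift_tens X (f : V -> W -> X) v w : bilin f -> tlift f (tens v w) = f v w.
Proof. by move=> bf; rewrite tlift_pi // big_seq1. Qed.

Lemma tens_bilin : bilin tens.
Proof.
split=> [w a u v|v a u w]; apply: tensor_ext => X f bf;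
  rewrite (tlift_linear bf) !tlift_tens //.
- exact: bf.1.
- exact: bf.2.
Qed.

Lemma tensorE (z : tensor) : z = \sum_(x <- repr z) tens x.1 x.2.
Proof.
apply: tensor_ext => X f bf; rewrite (lin_sum (tlift_linear bf)).
by apply: eq_bigr => x _; rewrite tlift_tens.
Qed.

Lemma tens_lin_ext X (f g : tensor -> X) : linear f -> linear g ->
  (forall v w, f (tens v w) = g (tens v w)) -> f =1 g.
Proof.
move=> lf lg h z; rewrite [z]tensorE !lin_sum //.
by apply: eq_bigr => x _; exact: h.
Qed.

End Tensor.

Section TliftParam.
Variables (K : comPzRingType) (U V W X : lmodType K).

Lemma tlift_param (F : U -> V -> W -> X) (z : tensor V W) :
  (forall v w, linear (fun u => F u v w)) -> linear (fun u => tlift (F u) z).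
Proof.
move=> lF a u v; rewrite /tlift scaler_sumr -big_split; apply: eq_bigr => x _.
exact: lF.
Qed.

End TliftParam.

Section TensorRing.
Variables (K : comNzRingType) (A B : algType K).
Local Notation T := (tensor A B).

Definition tmul (x y : T) : T :=
  tlift (fun a b => tlift (fun c d => tens (a * c) (b * d)) y) x.

Fact bilin_in a b : bilin (fun c d => tens (a * c) (b * d) : T).
Proof.
split=> [d k u v|c k u v]; rewrite mulrDr -scalerAr.
- exact: (tens_bilin _ _).1.
- exact: (tens_bilin _ _).2.
Qed.

Fact bilin_out y : bilin (fun a b => tlift (fun c d => tens (a * c) (b * d) : T) y).
Proof.
split=> [b|a]; apply: tlift_param => c d k u v; rewrite mulrDl -scalerAl.
- exact: (tens_bilin _ _).1.
- exact: (tens_bilin _ _).2.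
Qed.

Lemma tmul_linl y : linear (tmul^~ y).
Proof. exact: (tlift_linear (bilin_out y)). Qed.

Lemma tmul_linr x : linear (tmul x).
Proof.
move=> k y z; rewrite /tmul {1 3 5}/tlift scaler_sumr -big_split.
by apply: eq_bigr => p _; exact: (tlift_linear (bilin_in _ _)).
Qed.

Lemma tmul_tens a b c d : tmul (tens a b) (tens c d) = tens (a * c) (b * d).
Proof. by rewrite /tmul (tlift_tens _ _ (bilin_out _)) (tlift_tens _ _ (bilin_in _ _)). Qed.

Fact linC (X Y Z : lmodType K) (f : Y -> Z) (g : X -> Y) :
  linear f -> linear g -> linear (fun x => f (g x)).
Proof. by move=> lf lg k x y; rewrite lg lf. Qed.

Fact lin_id (X : lmodType K) : linear (fun x : X => x).
Proof. by []. Qed.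

Fact tmulA : associative tmul.
Proof.
move=> x y z.
apply: (tens_lin_ext (f := tmul^~ (tmul y z)) (g := fun t => tmul (tmul t y) z) _ _ _ x).
- exact: tmul_linl.
- exact: (linC (tmul_linl z) (tmul_linl y)).
move=> a b.
apply: (tens_lin_ext (f := fun t => tmul (tens a b) (tmul t z))
                     (g := fun t => tmul (tmul (tens a b) t) z) _ _ _ y).
- exact: (linC (tmul_linr _) (tmul_linl z)).
- exact: (linC (tmul_linl z) (tmul_linr _)).
move=> c d.
apply: (tens_lin_ext (f := fun t => tmul (tens a b) (tmul (tens c d) t))
                     (g := tmul (tmul (tens a b) (tens c d))) _ _ _ z).
- exact: (linC (tmul_linr _) (tmul_linr _)).
- exact: tmul_linr.
by move=> e f; rewrite !tmul_tens !mulrA.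
Qed.

Fact tmul1x : left_id (tens 1 1) tmul.
Proof.
move=> x; apply: (tens_lin_ext (tmul_linr _) (@lin_id _) _ x) => a b.
by rewrite tmul_tens !mul1r.
Qed.

Fact tmulx1 : right_id (tens 1 1) tmul.
Proof.
move=> x; apply: (tens_lin_ext (tmul_linl _) (@lin_id _) _ x) => a b.
by rewrite tmul_tens !mulr1.
Qed.

Fact tmulDl : left_distributive tmul +%R.
Proof. by move=> x y z; exact: (linD (tmul_linl z)). Qed.

Fact tmulDr : right_distributive tmul +%R.
Proof. by move=> x y z; exact: (linD (tmul_linr x)). Qed.

HB.instance Definition _ :=
  GRing.Zmodule_isPzRing.Build T tmulA tmul1x tmulx1 tmulDl tmulDr.

Lemma tensM a b c d : (tens a b * tens c d : T) = tens (a * c) (b * d).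
Proof. exact: tmul_tens. Qed.

End TensorRing.

HB.mixin Record isLie (R : pzRingType) L of GRing.Lmodule R L := {
  lie : L -> L -> L;
  lie_linl : forall y, linear (lie^~ y);
  liexx : forall x, lie x x = 0;
  lie_jacobi : forall x y z,
    lie x (lie y z) + lie y (lie z x) + lie z (lie x y) = 0
}.
#[short(type="lieType")]
HB.structure Definition Lie (R : pzRingType) := {L of isLie R L & GRing.Lmodule R L}.

Section UEA.
Variables (R : realType) (g : lieType R).
Local Notation C := R[i].

Inductive uterm :=
  | Ugen of g
  | Uone
  | Uadd of uterm & uterm
  | Uscale of C & uterm
  | Umul of uterm & uterm.

HB.instance Definition _ := gen_eqMixin uterm.
HB.instance Definition _ := gen_choiceMixin uterm.

(* The congruence presenting U(g), complexified: the axioms of a unital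
   associative C-algebra, R-linearity of the generators, xy - yx = [x, y].
   The zero of the algebra is 0 *: a, for any a. *)
Inductive ucong : uterm -> uterm -> Prop :=
  | ucong_refl a : ucong a a
  | ucong_sym a b : ucong a b -> ucong b a
  | ucong_trans b a c : ucong a b -> ucong b c -> ucong a c
  | ucong_add a a' b b' : ucong a a' -> ucong b b' -> ucong (Uadd a b) (Uadd a' b')
  | ucong_scale k a a' : ucong a a' -> ucong (Uscale k a) (Uscale k a')
  | ucong_mul a a' b b' : ucong a a' -> ucong b b' -> ucong (Umul a b) (Umul a' b')
  | ucong_addA a b c : ucong (Uadd a (Uadd b c)) (Uadd (Uadd a b) c)
  | ucong_addC a b : ucong (Uadd a b) (Uadd b a)
  | ucong_add0 a b : ucong (Uadd (Uscale 0 b) a) a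
  | ucong_scaleA k l a : ucong (Uscale k (Uscale l a)) (Uscale (k * l) a)
  | ucong_scale1 a : ucong (Uscale 1 a) a
  | ucong_scaleDl k l a : ucong (Uscale (k + l) a) (Uadd (Uscale k a) (Uscale l a))
  | ucong_scaleDr k a b : ucong (Uscale k (Uadd a b)) (Uadd (Uscale k a) (Uscale k b))
  | ucong_mulA a b c : ucong (Umul a (Umul b c)) (Umul (Umul a b) c)
  | ucong_mul1l a : ucong (Umul Uone a) a
  | ucong_mul1r a : ucong (Umul a Uone) a
  | ucong_mulDl a b c : ucong (Umul (Uadd a b) c) (Uadd (Umul a c) (Umul b c))
  | ucong_mulDr a b c : ucong (Umul a (Uadd b c)) (Uadd (Umul a b) (Umul a c))
  | ucong_scaleAl k a b : ucong (Uscale k (Umul a b)) (Umul (Uscale k a) b)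
  | ucong_scaleAr k a b : ucong (Uscale k (Umul a b)) (Umul a (Uscale k b))
  | ucong_gen (k : R) x y :
      ucong (Ugen (k *: x + y)) (Uadd (Uscale k%:C (Ugen x)) (Ugen y))
  | ucong_lie x y :
      ucong (Ugen (lie x y))
            (Uadd (Umul (Ugen x) (Ugen y)) (Uscale (-1) (Umul (Ugen y) (Ugen x)))).

Definition ueq (a b : uterm) : bool := `[< ucong a b >].

Fact ueq_refl : reflexive ueq.
Proof. by move=> a; apply/asboolP; exact: ucong_refl. Qed.
Fact ueq_sym : symmetric ueq.
Proof. by move=> a b; apply/asboolP/asboolP; exact: ucong_sym. Qed.
Fact ueq_trans : transitive ueq.
Proof. by move=> b a c /asboolP h /asboolP h'; apply/asboolP; exact: ucong_trans h'. Qed.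

Canonical ueq_equiv := EquivRel ueq ueq_refl ueq_sym ueq_trans.

Definition uea := {eq_quot ueq_equiv}.
HB.instance Definition _ := Choice.on uea.
HB.instance Definition _ := EqQuotient.on uea.

Definition uin (x : g) : uea := \pi_uea (Ugen x).

Lemma ucong_pi a b : ucong a b -> \pi_uea a = \pi_uea b.
Proof. by move=> h; apply/eqmodP/asboolP. Qed.

Lemma ucong_repr a : ucong (repr (\pi_uea a)) a.
Proof.
by have /eqmodP/asboolP : repr (\pi_uea a) = a %[mod uea] by rewrite reprK.
Qed.

Definition uadd (x y : uea) : uea := \pi_uea (Uadd (repr x) (repr y)).
Definition uscale k (x : uea) : uea := \pi_uea (Uscale k (repr x)).
Definition umul (x y : uea) : uea := \pi_uea (Umul (repr x) (repr y)).
Definition uone : uea := \pi_uea Uone.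
Definition uzero : uea := \pi_uea (Uscale 0 Uone).
Definition uopp := uscale (-1).

Fact uaddE a b : uadd (\pi_uea a) (\pi_uea b) = \pi_uea (Uadd a b).
Proof. by apply/ucong_pi/ucong_add; exact: ucong_repr. Qed.
Fact uscaleE k a : uscale k (\pi_uea a) = \pi_uea (Uscale k a).
Proof. by apply/ucong_pi/ucong_scale/ucong_repr. Qed.
Fact umulE a b : umul (\pi_uea a) (\pi_uea b) = \pi_uea (Umul a b).
Proof. by apply/ucong_pi/ucong_mul; exact: ucong_repr. Qed.

Fact uaddA : associative uadd.
Proof.
by elim/quotW=> a; elim/quotW=> b; elim/quotW=> c; rewrite (uaddE b) (uaddE a b) !uaddE; apply/ucong_pi/ucong_addA.
Qed.
Fact uaddC : commutative uadd.
Proof. by elim/quotW=> a; elim/quotW=> b; rewrite !uaddE; apply/ucong_pi/ucong_addC. Qed.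
Fact uadd0 : left_id uzero uadd.
Proof. by elim/quotW=> a; rewrite uaddE; apply/ucong_pi/ucong_add0. Qed.
Fact uaddN : left_inverse uzero uopp uadd.
Proof.
elim/quotW=> a; rewrite /uopp uscaleE uaddE; apply/ucong_pi.
apply: (@ucong_trans (Uscale (-1 + 1) a)).
  apply: ucong_sym; apply: ucong_trans (ucong_scaleDl _ _ _) _.
  by apply: ucong_add (ucong_refl _) (ucong_scale1 _).
rewrite addNr; apply: ucong_trans (ucong_add0 _ a).
apply: ucong_trans (ucong_addC _ _).
exact/ucong_sym/ucong_add0.
Qed.

HB.instance Definition _ := GRing.isZmodule.Build uea uaddA uaddC uadd0 uaddN.

Fact piD a b : \pi_uea a + \pi_uea b = \pi_uea (Uadd a b).
Proof. exact: uaddE. Qed.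

Fact uscaleA k l x : uscale k (uscale l x) = uscale (k * l) x.
Proof. by elim/quotW: x => a; rewrite (uscaleE l) !uscaleE; apply/ucong_pi/ucong_scaleA. Qed.
Fact uscale1 : left_id 1 uscale.
Proof. by elim/quotW=> a; rewrite uscaleE; apply/ucong_pi/ucong_scale1. Qed.
Fact uscaleDr : right_distributive uscale +%R.
Proof.
move=> k; elim/quotW=> a; elim/quotW=> b.
by rewrite (piD a b) (uscaleE k a) (uscaleE k b) uscaleE piD; apply/ucong_pi/ucong_scaleDr.
Qed.
Fact uscaleDl x : {morph uscale^~ x : k l / k + l}.
Proof.
by move=> k l; elim/quotW: x => a; rewrite (uscaleE k) (uscaleE l) uscaleE piD; apply/ucong_pi/ucong_scaleDl.
Qed.

HB.instance Definition _ :=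
  GRing.Zmodule_isLmodule.Build C uea uscaleA uscale1 uscaleDr uscaleDl.

Fact piZ (k : C) a : k *: \pi_uea a = \pi_uea (Uscale k a).
Proof. exact: uscaleE. Qed.

Fact umulA : associative umul.
Proof.
by elim/quotW=> a; elim/quotW=> b; elim/quotW=> c; rewrite (umulE b) (umulE a b) !umulE; apply/ucong_pi/ucong_mulA.
Qed.
Fact umul1x : left_id uone umul.
Proof. by elim/quotW=> a; rewrite umulE; apply/ucong_pi/ucong_mul1l. Qed.
Fact umulx1 : right_id uone umul.
Proof. by elim/quotW=> a; rewrite umulE; apply/ucong_pi/ucong_mul1r. Qed.
Fact umulDl : left_distributive umul +%R.
Proof.
elim/quotW=> a; elim/quotW=> b; elim/quotW=> c.
by rewrite (piD a) (umulE a) (umulE b) umulE piD; apply/ucong_pi/ucong_mulDl.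
Qed.
Fact umulDr : right_distributive umul +%R.
Proof.
elim/quotW=> a; elim/quotW=> b; elim/quotW=> c.
by rewrite (piD b) (umulE a b) (umulE a c) umulE piD; apply/ucong_pi/ucong_mulDr.
Qed.

HB.instance Definition _ :=
  GRing.Zmodule_isPzRing.Build uea umulA umul1x umulx1 umulDl umulDr.

Fact piM a b : \pi_uea a * \pi_uea b = \pi_uea (Umul a b).
Proof. exact: umulE. Qed.

(* Representations, algebraically: complex-linear operators on V, depending
   real-linearly on g and compatible with the brackets. *)
Definition lie_rep (V : lmodType C) (rho : g -> V -> V) :=
  [/\ forall x, linear (rho x),
      forall (k : R) x y v, rho (k *: x + y) v = k%:C *: rho x v + rho y v &
      forall x y v, rho (lie x y) v = rho x (rho y v) - rho y (rho x v)].

Fixpoint uev (V : lmodType C) (rho : g -> V -> V) (a : uterm) (v : V) : V :=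
  match a with
  | Ugen x => rho x v
  | Uone => v
  | Uadd a b => uev rho a v + uev rho b v
  | Uscale k a => k *: uev rho a v
  | Umul a b => uev rho a (uev rho b v)
  end.

Lemma uev_linear (V : lmodType C) (rho : g -> V -> V) a :
  lie_rep rho -> linear (uev rho a).
Proof.
case=> lr _ _; elim: a => [x|//|a IHa b IHb|k a IHa|a IHa b IHb] l u v /=.
- exact: lr.
- by rewrite IHa IHb scalerDr addrACA.
- by rewrite IHa scalerDr !scalerA mulrC.
- by rewrite IHb IHa.
Qed.

Lemma uev_ucong (V : lmodType C) (rho : g -> V -> V) a b :
  lie_rep rho -> ucong a b -> uev rho a =1 uev rho b.
Proof.
move=> hr; have lr := uev_linear _ hr; case: hr => _ hg hl.
elim=> {a b} //=.
- by move=> a b _ h v; rewrite h.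
- by move=> b a c _ h _ h' v; rewrite h h'.
- by move=> a a' b b' _ h _ h' v; rewrite h h'.
- by move=> k a a' _ h v; rewrite h.
- by move=> a a' b b' _ h _ h' v; rewrite h h'.
- by move=> a b c v; rewrite addrA.
- by move=> a b v; rewrite addrC.
- by move=> a b v; rewrite scale0r add0r.
- by move=> k l a v; rewrite scalerA.
- by move=> a v; rewrite scale1r.
- by move=> k l a v; rewrite scalerDl.
- by move=> k a b v; rewrite scalerDr.
- by move=> a b c v; rewrite (linD (lr _)).
- by move=> k a b v; rewrite (linZ (lr _)).
- by move=> x y v; rewrite scaleN1r.
Qed.

(* uact rho u v is u |> v; it is independent of the representative of u when
   rho is a representation (uact_pi). *)
Definition uact (V : lmodType C) (rho : g -> V -> V) (u : uea) : V -> V :=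
  uev rho (repr u).

Section UactTheory.
Variables (V : lmodType C) (rho : g -> V -> V).
Hypothesis hr : lie_rep rho.

Lemma uact_pi a : uact rho (\pi_uea a) =1 uev rho a.
Proof. exact/uev_ucong/ucong_repr. Qed.

Lemma uact_linear u : linear (uact rho u).
Proof. exact: uev_linear. Qed.

Lemma uact_in x v : uact rho (uin x) v = rho x v.
Proof. exact: uact_pi. Qed.

Lemma uact1 v : uact rho 1 v = v.
Proof. exact: uact_pi. Qed.

Lemma uactM u u' v : uact rho (u * u') v = uact rho u (uact rho u' v).
Proof.
by elim/quotW: u => a; elim/quotW: u' => b; rewrite piM !uact_pi.
Qed.

Lemma uact_lin v : linear (uact rho ^~ v).
Proof.
move=> k; elim/quotW=> a; elim/quotW=> b.
by rewrite /= piZ piD !uact_pi.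
Qed.

End UactTheory.

Fact uea_nz : (1 : uea) != 0.
Proof.
have hr : lie_rep (fun (_ : g) (_ : C^o) => 0 : C^o).
  by split=> [x k u v|k x y v|x y v]; rewrite ?scaler0 ?addr0 ?subrr.
apply/eqP => /(congr1 (fun u => uact (fun (_ : g) (_ : C^o) => 0 : C^o) u 1)).
rewrite uact1 // (lin0 (uact_lin hr 1)) => /eqP.
by rewrite oner_eq0.
Qed.

HB.instance Definition _ := GRing.PzSemiRing_isNonZero.Build uea uea_nz.

Fact uscaleAl k (x y : uea) : k *: (x * y) = (k *: x) * y.
Proof.
elim/quotW: x => a; elim/quotW: y => b.
rewrite (piM a b) (piZ k a) piZ piM; exact/ucong_pi/ucong_scaleAl.
Qed.

HB.instance Definition _ := GRing.Lmodule_isLalgebra.Build C uea uscaleAl.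

Fact uscaleAr k (x y : uea) : k *: (x * y) = x * (k *: y).
Proof.
elim/quotW: x => a; elim/quotW: y => b.
rewrite (piM a b) (piZ k b) piZ piM; exact/ucong_pi/ucong_scaleAr.
Qed.

HB.instance Definition _ := GRing.Lalgebra_isAlgebra.Build C uea uscaleAr.

Lemma uin_lie x y : uin (lie x y) = uin x * uin y - uin y * uin x.
Proof.
rewrite -scaleN1r /uin (piM (Ugen x)) (piM (Ugen y)) piZ piD; exact/ucong_pi/ucong_lie.
Qed.

Lemma uin_linear (k : R) x y : uin (k *: x + y) = k%:C *: uin x + uin y.
Proof. by rewrite /uin piZ piD; exact/ucong_pi/ucong_gen. Qed.

Definition uact2 (V W : lmodType C) (rhoV : g -> V -> V) (rhoW : g -> W -> W)
    (F : tensor uea uea) (z : tensor V W) : tensor V W :=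
  tlift (fun a b => tlift (fun v w => tens (uact rhoV a v) (uact rhoW b w)) z) F.

Lemma uact2_tens (V W : lmodType C) (rhoV : g -> V -> V) (rhoW : g -> W -> W) a b v w :
  lie_rep rhoV -> lie_rep rhoW ->
  uact2 rhoV rhoW (tens a b) (tens v w) = tens (uact rhoV a v) (uact rhoW b w).
Proof.
move=> hV hW; rewrite /uact2 !tlift_tens //; split.
- by move=> w' k u u'; rewrite uact_linear //; exact: (tens_bilin _ _).1.
- by move=> v' k u u'; rewrite uact_linear //; exact: (tens_bilin _ _).2.
- move=> b'; apply: tlift_param => v' w' k u u'.
  by rewrite uact_lin //; exact: (tens_bilin _ _).1.
- move=> a'; apply: tlift_param => v' w' k u u'.
  by rewrite uact_lin //; exact: (tens_bilin _ _).2.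
Qed.

End UEA.

Section Seminorms.
Variable R : realType.
Local Notation C := R[i].

Definition seminorm (V : lmodType C) (p : V -> R) :=
  (forall u v, p (u + v) <= p u + p v) /\
  (forall (a : C) v, p (a *: v) = ComplexField.Normc.normc a * p v).

Definition cs (V : tvsType C) : set (V -> R) :=
  [set p | seminorm p /\ continuous p].
Arguments cs V : clear implicits.

(* The projective tensor product of p on the subspace A and q on the subspace
   B.  As V and W are vector spaces, A (x) B embeds into V (x) W; the infimum
   runs over the representations of z by elements of A and B only. *)
Definition ptens (V W : lmodType C) (A : set V) (B : set W)
    (p : V -> \bar R) (q : W -> \bar R) (z : tensor V W) : \bar R :=
  ereal_inf [set (\sum_(x <- s) p x.1 * q x.2)%E | s in
    [set s : seq (V * W) | (forall x, x \in s -> A x.1 /\ B x.2) /\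
                           \sum_(x <- s) tens x.1 x.2 = z]].

(* Continuity of a linear map for the projective topology on V (x) W, which is
   defined by the (upward directed) family of the seminorms p (x) q. *)
Definition proj_continuous (V W X : tvsType C) (f : tensor V W -> X) :=
  forall qX, cs X qX -> exists p q, [/\ cs V p, cs W q &
    forall z, ((qX (f z))%:E <= ptens setT setT (EFin \o p) (EFin \o q) z)%E].

(* A fully reduced inductive system with inductive limit V.  The subspaces
   carry their own topologies and come with their (injective) inclusions. *)
Record indsys (V : tvsType C) := IndSys {
  idx : Type;
  idx_le : idx -> idx -> Prop;
  idx_refl : forall a, idx_le a a;
  idx_trans : forall a b c, idx_le a b -> idx_le b c -> idx_le a c;
  idx_dir : forall a b, exists c, idx_le a c /\ idx_le b c;
  stage : idx -> tvsType C;
  incl : forall a, {linear stage a -> V};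
  incl_inj : forall a, injective (incl a);
  incl_le : forall a b, idx_le a b -> exists j : stage a -> stage b,
    continuous j /\ forall v, incl b (j v) = incl a v;
  incl_cover : forall v, exists a v', incl a v' = v;
  (* V carries the final locally convex topology. *)
  incl_cont : forall a, continuous (incl a);
  incl_final : forall (Y : tvsType C) (f : {linear V -> Y}),
    (forall a, continuous (f \o incl a)) -> continuous f
}.

End Seminorms.
Arguments cs {R} V.
Arguments idx {R V} S : rename.
Arguments stage {R V} S a : rename.
Arguments incl {R V} S a : rename.

Section Representations.
Variables (R : realType) (g : lieType R).
Local Notation C := R[i].

Record rep (V : tvsType C) := Rep {
  rep_fun :> g -> V -> V;
  rep_lie : lie_rep rep_fun;
  rep_cont : forall x, continuous (rep_fun x)
}.

(* p^(s)_{r,q}; Bg is the unit ball of g. *)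
Definition pnorm (Bg : set g) (V : tvsType C) (rho : rep V) (s r : R)
    (q : V -> R) (v : V) : \bar R :=
  (\sum_(0 <= n <oo) ((n`!%:R `^ (s - 1) * r ^+ n)%R%:E *
     ereal_sup [set (q (uact rho (\prod_(i < n) uin (xi i)) v))%:E |
                xi in [set xi : 'I_n -> g | forall i, Bg (xi i)]]))%E.

Definition analytic (Bg : set g) (V : tvsType C) (rho : rep V) (s r0 : R) : set V :=
  [set v | forall q r, cs V q -> 0 <= r < r0 -> (pnorm Bg rho s r q v < +oo)%E].

Definition entire (Bg : set g) (V : tvsType C) (rho : rep V) (s : R) : set V :=
  \bigcap_(r0 in [set r0 : R | 0 < r0]) analytic Bg rho s r0.

Definition malleable (V W X : tvsType C) (rhoV : rep V) (rhoW : rep W) (rhoX : rep X)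
    (mu : {linear tensor V W -> X}) :=
  forall x v w, rhoX x (mu (tens v w)) = mu (tens (rhoV x v) w + tens v (rhoW x w)).

Record inductive_triple (V W X : tvsType C) (rhoV : rep V) (rhoW : rep W)
    (rhoX : rep X) (mu : {linear tensor V W -> X}) := InductiveTriple {
  sysV : indsys V;
  sysW : indsys W;
  sysX : indsys X;
  resV : forall a, rep (stage sysV a);
  resVE : forall a x v, incl sysV a (resV a x v) = rhoV x (incl sysV a v);
  resW : forall b, rep (stage sysW b);
  resWE : forall b x w, incl sysW b (resW b x w) = rhoW x (incl sysW b w);
  invX : forall c x u, exists u', incl sysX c u' = rhoX x (incl sysX c u);
  mu_stage : forall a b, exists c,
    exists2 f : {linear tensor (stage sysV a) (stage sysW b) -> stage sysX c},
      proj_continuous f &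
      forall v w, incl sysX c (f (tens v w)) = mu (tens (incl sysV a v) (incl sysW b w))
}.

End Representations.
Arguments resV {R g V W X rhoV rhoW rhoX mu} T a : rename.
Arguments resW {R g V W X rhoV rhoW rhoX mu} T b : rename.

Section Twist.
Variables (R : realType) (d : nat).
Local Notation C := R[i].

(* Rows and columns are numbered from 1 to d. *)
Definition munit (n k : nat) : 'M[R]_d :=
  \matrix_(i, j) ((i.+1 == n) && (j.+1 == k))%:R.

Definition mH (n : nat) : 'M[R]_d := munit n n - munit n.+1 n.+1.

Definition mlie (A B : 'M[R]_d) : 'M[R]_d := A *m B - B *m A.

Definition lie_subalg (U : set 'M[R]_d) :=
  [/\ U 0, forall (a : R) A B, U A -> U B -> U (a *: A + B) &
      forall A B, U A -> U B -> U (mlie A B)].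

Definition lie_span (S : set 'M[R]_d) : set 'M[R]_d :=
  [set A | forall U, lie_subalg U -> S `<=` U -> U A].

Definition gens : set 'M[R]_d := [set A |
  [\/ exists2 n, 1 <= n <= d.-1 & A = mH n,
      exists2 n, 2 <= n <= d & A = munit 1 n |
      exists2 n, 1 <= n <= d.-1 & A = munit n d]%N].

Definition calH_pred : {pred 'M[R]_d} := fun A => `[< lie_span gens A >].

Fact calH_submod : submod_closed calH_pred.
Proof.
split=> [|a A B /asboolP hA /asboolP hB]; apply/asboolP => U hU gU.
  by case: hU.
by case: (hU) => _ h _; apply: h; [exact: hA | exact: hB].
Qed.

HB.instance Definition _ :=
  GRing.isSubmodClosed.Build R 'M[R]_d calH_pred calH_submod.

Record calH := CalH { calH_val :> 'M[R]_d; calHP : calH_val \in calH_pred }.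
HB.instance Definition _ := [isSub for calH_val].
HB.instance Definition _ := [Choice of calH by <:].
HB.instance Definition _ := [SubChoice_isSubLmodule of calH by <:].

Fact mlie_calH (A B : calH) : mlie A B \in calH_pred.
Proof.
apply/asboolP => U hU gU; case: (hU) => _ _; apply.
- by have /asboolP := calHP A; apply.
- by have /asboolP := calHP B; apply.
Qed.

Definition calH_lie (A B : calH) : calH := CalH (mlie_calH A B).

Fact calH_lie_linl B : linear (calH_lie^~ B).
Proof.
move=> a A A'; apply: val_inj; rewrite /= /mlie.
by rewrite mulmxDl mulmxDr -scalemxAl -scalemxAr scalerBr opprD addrACA.
Qed.

Fact calH_liexx A : calH_lie A A = 0.
Proof. by apply: val_inj; rewrite /= /mlie subrr. Qed.

Fact calH_jacobi A B D :
  calH_lie A (calH_lie B D) + calH_lie B (calH_lie D A) + calH_lie D (calH_lie A B) = 0.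
Proof.
apply: val_inj; rewrite /= /mlie !(mulmxBl, mulmxBr) !mulmxA.
apply/matrixP => i j; rewrite !mxE; ring.
Qed.

HB.instance Definition _ :=
  isLie.Build R calH calH_lie_linl calH_liexx calH_jacobi.

Definition calH_ball : set calH :=
  [set A : calH | Num.sqrt (\sum_i \sum_j (calH_val A i j) ^+ 2) < 1].

Definition inH (A : 'M[R]_d) : calH := insubd (0 : calH) A.

(* inH is the identity on the elements of calH (see inH_gen for the
   generators) and 0 elsewhere; it is only applied to generators. *)
Definition uE (n k : nat) : uea calH := uin (inH (munit n k)).
Definition uH (n : nat) : uea calH := uin (inH (mH n)).

Lemma inH_gen A : gens A -> val (inH A) = A.
Proof. by move=> gA; rewrite insubdK //; apply/asboolP => U _; apply. Qed.

Lemma munit_tr n k : \tr (munit n k) = ((n == k) && (0 < n <= d)%N)%:R.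
Proof.
rewrite /mxtrace; case: (ltnP 0 n) => [n0|]; last first.
  by rewrite leqn0 => /eqP ->; rewrite /= andbF big1 // => i _; rewrite mxE.
case: (leqP n d) => [nd|dn]; last first.
  rewrite /= andbF big1 // => i _; rewrite mxE.
  by rewrite (ltn_eqF (leq_ltn_trans (ltn_ord i) dn)).
have nd' : (n.-1 < d)%N by rewrite prednK.
rewrite /= andbT (bigD1 (Ordinal nd')) //= big1 ?addr0 => [|i /eqP ni].
  by rewrite mxE /= prednK // eqxx.
rewrite mxE; case: eqP => // h; case: ni; apply: val_inj.
by rewrite /= -h.
Qed.

Lemma calH_tr (A : calH) : \tr (val A) = 0.
Proof.
have /asboolP h := calHP A; apply: (h [set B : 'M[R]_d | \tr B = 0]).
  split=> [|a B D|B D _ _].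
  - exact: mxtrace0.
  - by move=> /= hB hD; rewrite mxtraceD mxtraceZ hB hD mulr0 addr0.
  - by rewrite /= /mlie linearB /= mxtrace_mulC subrr.
move=> B [[n /andP[n1 nd]] ->|[n /andP[n2 nd]] ->|[n /andP[n1 nd]] ->] /=.
- rewrite /mH linearB /= !munit_tr !eqxx n1 ltn0Sn /=.
  have nd' : (n < d)%N by case: (d) nd n1 => [|d'] //=; case: n.
  by rewrite (ltnW nd') nd' subrr.
- by rewrite munit_tr; case: n n2 nd => [|[|n]].
- rewrite munit_tr; have nd' : (n < d)%N by case: (d) nd n1 => [|d'] //=; case: n.
  by rewrite (ltn_eqF nd').
Qed.

Definition rising (Y : uea calH) (k : nat) : uea calH := \prod_(j < k) (Y + j%:R).

Variable c : nat -> C.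

Definition twH : uea calH := 2^-1 *: \sum_(1 <= s < d) c s *: uH s.

Definition twX : tensor (uea calH) (uea calH) := \sum_(2 <= s < d) tens (uE 1 s) (uE s d).

Definition twF (n : nat) : tensor (uea calH) (uea calH) :=
  \sum_(m < n.+1)
    (twX ^+ m * tens (rising (twH + m%:R) (n - m)) (uE 1 d ^+ (n - m))) *+ 'C(n, m).

End Twist.

(* Main.v *)
Require Import Defs.
From mathcomp Require Import all_boot all_order all_algebra.
From mathcomp Require Import complex.
From mathcomp Require Import finmap.
From mathcomp Require Import all_classical all_reals all_analysis.
From mathcomp Require Import ring lra.
Set Implicit Arguments.
Unset Strict Implicit.
Unset Printing Implicit Defensive.
Import Order.TTheory GRing.Theory Num.Theory.
Import numFieldNormedType.Exports.
Local Open Scope classical_set_scope.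
Local Open Scope ring_scope.

(** The exponent of [n!] in the seminorms vanishes at order one, so that a
    vector on which [p_{r,q}] is finite satisfies [q (x1 ... xn v) <= P / r ^ n]
    for all [x1, ..., xn] in the unit ball.  On such vectors the Lie algebra
    acts, for the seminorm [p_{r,q}], by bounded operators of norm [O (1 / r)].
    Commutation with a bounded operator has bounded eigenvalues: if [D] is in the
    Lie algebra and [b] in the enveloping algebra satisfies [D b - b D = k b],
    then [q (b v) = 0] as soon as [k r] exceeds a constant depending on [D] only
    ([eigen_vanish]).

    For [D = diag (1, ..., 1, 1 - d)] every [E s d] with [s < d] satisfies
    [[D, E s d] = d E s d].  All monomials of [F n] have exactly [n] such factors
    on the right of the tensor sign, hence eigenvalue [n d] ([twF_eigen]).
    Consequently the seminorms of [F n] applied to [v (x) w] vanish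

    - for all [n > 0] if [w] is entire, because every [r] is allowed.  Claim (A)
      therefore reduces to [F 0 = 1], with unchanged seminorms and constants one;

    - for all [n >= N] if [w] is analytic of radius [r2], where [N] depends on
      [r2] only.  Claim (B) is then a statement about finitely many elements of
      the tensor square of the enveloping algebra.

    What remains for (B) is a bound for one element [u] of the enveloping
    algebra with constants that stay finite as [r] tends to zero; the bound
    of order [1 / r] is of no use there.  To estimate [q (x1 ... xn u v)], the
    element [u] is commuted to the left through the word and then absorbed
    into a new continuous seminorm [q'].  Each letter of the word doubles the
    number of terms, and the bracket is bounded on the ball, so that this costs
    a factor [2 ^ n] for small [r], which is compensated by replacing [r] by a
    multiple [t r] ([word_commute], [uact_uniformly_bounded]).  That [q'] is
    continuous uses that the Lie algebra has finite dimension. *)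

(** * Eigenvectors of an inner derivation *)

Section Eigen.
Variables (R : realType) (g : lieType R) (D : g).
Local Notation C := R[i].

Definition ad_eigen (k : R) (b : uea g) := uin D * b - b * uin D = k%:C%C *: b.

Lemma ad_eigen1 : ad_eigen 0 1.
Proof. by rewrite /ad_eigen mulr1 mul1r subrr scale0r. Qed.

Lemma ad_eigenM k l a b : ad_eigen k a -> ad_eigen l b -> ad_eigen (k + l) (a * b).
Proof.
move=> ha hb; rewrite /ad_eigen rmorphD scalerDl scalerAl -ha scalerAr -hb.
by rewrite mulrBl mulrBr !mulrA addrA subrK.
Qed.

Lemma ad_eigenX k b n : ad_eigen k b -> ad_eigen (n%:R * k) (b ^+ n).
Proof.
move=> hb; elim: n => [|n IH]; first by rewrite mul0r; apply: ad_eigen1.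
by rewrite exprS -natr1 mulrDl mul1r addrC; apply: ad_eigenM.
Qed.

Lemma ad_eigen_uin k x : lie D x = k *: x -> ad_eigen k (uin x).
Proof.
move=> h; rewrite /ad_eigen -uin_lie h.
have u0 : uin (0 : g) = 0.
  by have := uin_linear 1 (0 : g) 0; rewrite !scale1r addr0 -{1}[uin 0]addr0 => /addrI.
by have := uin_linear k x 0; rewrite addr0 u0 addr0.
Qed.

(** An eigenvalue equation in the tensor product would not provide the
    decomposition into pure tensors by which projective seminorms are
    estimated, hence the existential form. *)
Definition right_eigen (k : R) (F : tensor (uea g) (uea g)) :=
  exists2 s : seq (uea g * uea g), F = \sum_(x <- s) tens x.1 x.2 &
    forall x, x \in s -> ad_eigen k x.2.

Lemma right_eigen_tens k a b : ad_eigen k b -> right_eigen k (tens a b).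
Proof.
move=> hb; exists [:: (a, b)]; first by rewrite big_seq1.
by move=> x; rewrite inE => /eqP ->.
Qed.

Lemma right_eigen_sum k (I : eqType) (s : seq I) F : (forall i, i \in s -> right_eigen k (F i)) ->
  right_eigen k (\sum_(i <- s) F i).
Proof.
elim: s => [|i s IH] h; first by exists [::]; rewrite ?big_nil.
have [t1 e1 h1] := h i (mem_head _ _).
have [|t2 e2 h2] := IH; first by move=> j hj; apply: h; rewrite inE hj orbT.
exists (t1 ++ t2); first by rewrite big_cons big_cat e1 e2.
by move=> x; rewrite mem_cat => /orP[/h1|/h2].
Qed.

Lemma right_eigenMn k F n : right_eigen k F -> right_eigen k (F *+ n).
Proof.
by move=> hF; rewrite -(card_ord n) -sumr_const -big_enum; apply: right_eigen_sum.
Qed.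

Lemma right_eigenM k l F G : right_eigen k F -> right_eigen l G ->
  right_eigen (k + l) (F * G).
Proof.
move=> [s -> hs] [t -> ht]; exists [seq (x.1 * y.1, x.2 * y.2) | x <- s, y <- t].
  rewrite big_allpairs_dep mulr_suml; apply: eq_bigr => x _.
  by rewrite mulr_sumr; apply: eq_bigr => y _; rewrite tensM.
by move=> _ /allpairsP[[x y] [/= /hs hx /ht hy ->]]; apply: ad_eigenM.
Qed.

Lemma right_eigenX k F n : right_eigen k F -> right_eigen (n%:R * k) (F ^+ n).
Proof.
move=> hF; elim: n => [|n IH]; first by rewrite mul0r; apply/right_eigen_tens/ad_eigen1.
by rewrite exprS -natr1 mulrDl mul1r addrC; apply: right_eigenM.
Qed.

End Eigen.

(** * Words in the unit ball *)

Section Words.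
Variables (R : realType) (g : lieType R) (B : set g).
Local Notation C := R[i].
Local Notation normc := (ComplexField.Normc.normc).

Hypothesis B_abs : forall x, exists2 M : R, 0 < M & B (M^-1 *: x).
Hypothesis B_br : exists2 c : R, 0 < c & forall x y, B x -> B y -> B (c^-1 *: lie x y).
Hypothesis B_fin : exists (es : seq g) (M : R), 0 <= M /\
  forall x, B x -> exists2 a : nat -> R, (forall i, `|a i| <= M) &
    x = \sum_(i < size es) a i *: es`_i.

Section SeminormFacts.
Variables (V : lmodType C) (q : V -> R).
Hypothesis hq : seminorm q.

Lemma seminormD u v : q (u + v) <= q u + q v.
Proof. exact: hq.1. Qed.

Lemma seminormZ a v : q (a *: v) = normc a * q v.
Proof. exact: hq.2. Qed.

Lemma normc_real (a : R) : normc a%:C%C = `|a|.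
Proof. by rewrite /= expr0n /= addr0 sqrtr_sqr. Qed.

Lemma normc_ge0 (a : C) : 0 <= normc a.
Proof. by case: a => a b; rewrite sqrtr_ge0. Qed.

Lemma seminormZr (a : R) v : q (a%:C%C *: v) = `|a| * q v.
Proof. by rewrite seminormZ normc_real. Qed.

Lemma seminorm0 : q 0 = 0.
Proof. by rewrite -(scale0r 0) (seminormZr 0) normr0 mul0r. Qed.

Lemma seminormN v : q (- v) = q v.
Proof.
have -> : - v = (-1 : R)%:C%C *: v by rewrite raddfN /= scaleN1r.
by rewrite seminormZr normrN1 mul1r.
Qed.

Lemma seminormB u v : q (u - v) <= q u + q v.
Proof. by rewrite -(seminormN v) seminormD. Qed.

Lemma seminorm_ge0 v : 0 <= q v.
Proof.
have := seminormB v v; rewrite subrr seminorm0 -mulr2n pmulrn_lge0 //.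
Qed.

End SeminormFacts.

Section OneRep.
Variables (V : tvsType C) (rho : rep g V).
Implicit Types (q : V -> R) (xs : seq g).

Definition act xs (v : V) : V := foldr (fun x u => rho x u) v xs.

Definition ball_word xs := forall x, x \in xs -> B x.

Lemma ball_word_nil : ball_word [::].
Proof. by []. Qed.

Lemma ball_word_rcons xs x : ball_word xs -> B x -> ball_word (rcons xs x).
Proof. by move=> h hx y; rewrite mem_rcons inE => /orP[/eqP ->//|/h]. Qed.

Lemma ball_word_rconsP xs x : ball_word (rcons xs x) -> ball_word xs /\ B x.
Proof.
by move=> h; split=> [y hy|]; apply: h; rewrite mem_rcons inE ?hy ?orbT ?eqxx.
Qed.

Lemma act_rcons xs x v : act (rcons xs x) v = act xs (rho x v).
Proof. exact: foldr_rcons. Qed.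

Lemma rho_linear x : linear (rho x).
Proof. by case: (rep_lie rho). Qed.

Lemma act_linear xs : linear (act xs).
Proof.
by elim: xs => [//|x xs IH] k u v /=; rewrite IH rho_linear.
Qed.

Lemma rho_scale (a : R) x v : rho (a *: x) v = a%:C%C *: rho x v.
Proof.
have [_ h _] := rep_lie rho.
have r0 : rho 0 v = 0.
  by have := h 1 0 0 v; rewrite !scale1r addr0 -{1}[rho 0 v]addr0 => /addrI.
by have := h a x 0 v; rewrite addr0 r0 addr0.
Qed.

Lemma rho_lie x y v : rho x (rho y v) = rho y (rho x v) + rho (lie x y) v.
Proof. by have [_ _ ->] := rep_lie rho; rewrite addrC subrK. Qed.

(** [word_bound r q v P] bounds the terms of the series [p_{r,q} v], rather than
    its sum, by [P].  Enlarging [r] by a constant factor turns one kind of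
    bound into the other, and the termwise bounds need no convergence. *)
Definition word_bound (r : R) q (v : V) (P : R) :=
  forall xs, ball_word xs -> r ^+ size xs * q (act xs v) <= P.

Lemma word_bound_ge0 {r q v P} : seminorm q -> word_bound r q v P -> 0 <= P.
Proof.
by move=> hq /(_ _ ball_word_nil) /=; rewrite mul1r; apply: le_trans; apply: seminorm_ge0.
Qed.

Lemma word_bound_mono r r' q q' v P : seminorm q -> 0 <= r <= r' ->
  (forall u, q u <= q' u) -> word_bound r' q' v P -> word_bound r q v P.
Proof.
move=> hq /andP[r0 rr'] qq' h xs hx; apply: le_trans (h xs hx).
apply: ler_pM => //; first exact: exprn_ge0.
  exact: seminorm_ge0.
by apply: lerXn2r; rewrite // nnegrE // (le_trans r0).
Qed.

Lemma word_bound_add r q u v P Q : seminorm q -> 0 <= r ->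
  word_bound r q u P -> word_bound r q v Q -> word_bound r q (u + v) (P + Q).
Proof.
move=> hq r0 hu hv xs hx; rewrite (linD (act_linear xs)).
apply: le_trans (lerD (hu xs hx) (hv xs hx)); rewrite -mulrDr.
by apply: ler_wpM2l; [apply: exprn_ge0 | apply: seminormD].
Qed.

Lemma word_bound_scale r q v P a : seminorm q -> 
  word_bound r q v P -> word_bound r q (a *: v) (normc a * P).
Proof.
move=> hq hv xs hx; rewrite (linZ (act_linear xs)) seminormZ // mulrCA.
by apply: ler_wpM2l (hv xs hx); apply: normc_ge0.
Qed.

(** Acting by an element of the ball only shifts the sequence of terms. *)
Lemma word_bound_rho r q v P x : 0 < r -> B x -> word_bound r q v P ->
  word_bound r q (rho x v) (P / r).
Proof.
move=> r0 hx hv xs hxs; rewrite ler_pdivlMr // mulrAC -exprSr -act_rcons.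
by have := hv _ (ball_word_rcons hxs hx); rewrite size_rcons.
Qed.

Lemma rho_rescale (M : R) x v : 0 < M -> rho x v = M%:C%C *: rho (M^-1 *: x) v.
Proof.
by move=> M0; rewrite rho_scale scalerA -rmorphM /= divff ?gt_eqF // scale1r.
Qed.

(** Every generator costs a factor of order [1 / r], so that the constant blows
    up at radius zero; [uact_uniformly_bounded] covers small radii. *)
Lemma word_bound_uact r q (u : uea g) : seminorm q -> 0 < r ->
  exists2 D : R, 0 <= D &
    forall v P, word_bound r q v P -> word_bound r q (uact rho u v) (D * P).
Proof.
move=> hq r0; have hr := rep_lie rho.
elim/quotW: u => a.
suff [D D0 hD] : exists2 D : R, 0 <= D &
    forall v P, word_bound r q v P -> word_bound r q (uev rho a v) (D * P).
  by exists D => // v P; rewrite uact_pi //; apply: hD.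
elim: a => [x||a [D D0 hD] b [E E0 hE]|k a [D D0 hD]|a [D D0 hD] b [E E0 hE]] /=.
- have [M M0 hM] := B_abs x; exists (M / r); first by rewrite divr_ge0 // ltW.
  move=> v P hv; rewrite (rho_rescale _ _ M0).
  have := word_bound_scale M%:C%C hq (word_bound_rho r0 hM hv).
  by rewrite normc_real gtr0_norm // mulrA mulrAC.
- by exists 1 => // v P; rewrite mul1r.
- exists (D + E) => [|v P hv]; first exact: addr_ge0.
  by rewrite mulrDl; apply: word_bound_add; rewrite ?ltW //; [apply: hD | apply: hE].
- exists (normc k * D) => [|v P hv]; first by rewrite mulr_ge0 ?normc_ge0.
  by rewrite -mulrA; apply: word_bound_scale => //; apply: hD.
- exists (D * E) => [|v P hv]; first exact: mulr_ge0.
  by rewrite -mulrA; apply/hD/hE.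
Qed.

(** An eigenvector [b] of [ad D] vanishes on vectors of large radius: there
    [ad D] has norm at most [2 M / r], where [M] measures the size of [D], so
    that a larger eigenvalue [k] forces the seminorms of [b w] to vanish.  Concretely
    [k b = D b - b D] is used [m] times, which multiplies the a priori bound of
    [b w] by [(2 M / (k r)) ^ m]. *)
Lemma eigen_vanish r q (D : g) (M k : R) (b : uea g) w P xs :
  seminorm q -> 0 < r -> 0 < M -> B (M^-1 *: D) -> 2 * M < k * r ->
  ad_eigen D k b ->
  word_bound r q w P -> ball_word xs -> q (act xs (uact rho b w)) = 0.
Proof.
move=> hq r0 M0 hD hk hb hw hxs; have hr := rep_lie rho.
have kr0 : 0 < k * r by apply: lt_trans hk; rewrite mulr_gt0.
have k0 : 0 < k by rewrite -(pmulr_lgt0 _ r0).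
have [E E0 hE] := word_bound_uact b hq r0.
have P0 := word_bound_ge0 hq hw.
pose D' := M^-1 *: D.
have eqb v : k%:C%C *: uact rho b v = M%:C%C *: (rho D' (uact rho b v) - uact rho b (rho D' v)).
  rewrite scalerBr -(linZ (uact_linear hr b) M%:C%C) -!(rho_rescale _ _ M0).
  rewrite -!(uact_in hr) -!uactM // -scaleN1r -(linZ (uact_lin hr v)).
  by rewrite -(linZ (uact_lin hr v)) -(linD (uact_lin hr v)) scaleN1r hb.
have key m : forall ys v Q, ball_word ys -> word_bound r q v Q ->
    (k * r) ^+ m * (r ^+ size ys * q (act ys (uact rho b v))) <= (2 * M) ^+ m * (E * Q).
  elim: m => [|m IH] ys v Q hys hv; first by rewrite !mul1r; apply: hE.
  have h1 := IH _ v Q (ball_word_rcons hys hD) hv.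
  have h2 := IH ys (rho D' v) (Q / r) hys (word_bound_rho r0 hD hv).
  rewrite size_rcons act_rcons -/D' in h1.
  have h3 : k * q (act ys (uact rho b v)) <=
      M * (q (act ys (rho D' (uact rho b v))) + q (act ys (uact rho b (rho D' v)))).
    have -> : k * q (act ys (uact rho b v)) = q (k%:C%C *: act ys (uact rho b v)).
      by rewrite seminormZr // gtr0_norm.
    rewrite -(linZ (act_linear ys)) eqb (linZ (act_linear ys)) seminormZr // gtr0_norm //.
    rewrite (linD (act_linear ys)) -scaleN1r (linZ (act_linear ys)) scaleN1r.
    by rewrite ler_pM2l // seminormB.
  set X := q (act ys (uact rho b v)) in h3 *.
  set Y := q _ in h1 h3; set Z := q (act ys (uact rho b _)) in h2 h3.
  have c0 : 0 <= (k * r) ^+ m * (r * r ^+ size ys).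
    by rewrite !mulr_ge0 ?exprn_ge0 // ltW.
  have := ler_wpM2l c0 h3.
  have -> : (k * r) ^+ m * (r * r ^+ size ys) * (k * X) = (k * r) ^+ m.+1 * (r ^+ size ys * X).
    by rewrite exprS; ring.
  move/le_trans; apply.
  have -> : (k * r) ^+ m * (r * r ^+ size ys) * (M * (Y + Z)) =
      M * ((k * r) ^+ m * (r ^+ (size ys).+1 * Y)) +
      r * M * ((k * r) ^+ m * (r ^+ size ys * Z)) by rewrite exprS; ring.
  have -> : (2 * M) ^+ m.+1 * (E * Q) =
      M * ((2 * M) ^+ m * (E * Q)) + r * M * ((2 * M) ^+ m * (E * (Q / r))).
    by rewrite exprS; field; rewrite gt_eqF.
  by apply: lerD; apply: ler_wpM2l; rewrite ?mulr_ge0 // ltW.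
set X := q _; apply/eqP; rewrite eq_le {2}/X seminorm_ge0 // andbT leNgt.
apply/negP => X0.
(* by [key], the ratio [2 M / (k r)] has no small powers unless [X = 0] *)
pose x := 2 * M / (k * r).
have x0 : 0 <= x by rewrite divr_ge0 ?mulr_ge0 // ltW.
have hx : `|x| < 1 by rewrite ger0_norm // ltr_pdivrMr // mul1r.
have a0 : 0 < r ^+ size xs * X / (E * P + 1).
  by rewrite divr_gt0 ?mulr_gt0 ?exprn_gt0 // ltr_wpDl // mulr_ge0.
have /cvgr0Pnorm_lt/(_ _ a0) [m _ /(_ m (leqnn m))] /= := cvg_expr hx.
rewrite ger0_norm ?exprn_ge0 // ltNge => /negP; apply.
rewrite ler_pdivrMr; last by rewrite ltr_wpDl // mulr_ge0.
rewrite /x expr_div_n mulrAC ler_pdivlMr ?exprn_gt0 // mulrC.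
apply: le_trans (key m xs w P hxs hw) _.
by rewrite ler_wpM2l ?lerDl // exprn_ge0 // mulr_ge0 // ltW.
Qed.

(** * Bounds uniform down to radius zero *)

Lemma csD q1 q2 : cs V q1 -> cs V q2 -> cs V (fun v => q1 v + q2 v).
Proof.
move=> [[a1 s1] c1] [[a2 s2] c2]; split; last by move=> v; apply: cvgD; [apply: c1|apply: c2].
split=> [u v|a v]; last by rewrite s1 s2 mulrDr.
by rewrite addrACA lerD.
Qed.

Lemma csZ (M : R) q : 0 <= M -> cs V q -> cs V (fun v => M * q v).
Proof.
move=> M0 [[a1 s1] c1]; split; last by move=> v; apply: cvgM; [apply: cvg_cst|apply: c1].
split=> [u v|a v]; last by rewrite s1 mulrCA.
by rewrite -mulrDr ler_wpM2l.
Qed.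

Lemma cs0 : cs V (fun=> 0).
Proof.
split; last by move=> v; apply: cvg_cst.
by split=> [u v|a v]; rewrite ?addr0 ?mulr0.
Qed.

Lemma cs_rho x q : cs V q -> cs V (fun v => q (rho x v)).
Proof.
move=> [[a1 s1] c1]; split.
  split=> [u v|a v]; first by rewrite (linD (rho_linear x)).
  by rewrite (linZ (rho_linear x)) s1.
by move=> v; apply: (@continuous_comp _ _ _ (rho x) q); [apply: rep_cont | apply: c1].
Qed.

Lemma cs_sum (es : seq g) q : cs V q -> cs V (fun v => \sum_(e <- es) q (rho e v)).
Proof.
move=> hq; elim: es => [|e es IH].
  by have -> : (fun v => \sum_(e <- [::]) q (rho e v)) = (fun=> 0);
    [apply/funext => v; rewrite big_nil | apply: cs0].
have -> : (fun v => \sum_(e' <- e :: es) q (rho e' v)) =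
    (fun v => q (rho e v) + \sum_(e' <- es) q (rho e' v)).
  by apply/funext => v; rewrite big_cons.
by apply: csD => //; apply: cs_rho.
Qed.

(** The supremum of [q (x v)] over [x] in the ball is dominated by a multiple of
    the sum over a basis of the Lie algebra, which is continuous. *)
Lemma cs_ball q : cs V q ->
  exists2 q', cs V q' & forall x v, B x -> q (rho x v) <= q' v.
Proof.
move=> hq; have [es [M [M0 hM]]] := B_fin.
exists (fun v => M * \sum_(e <- es) q (rho e v)); first exact/csZ/cs_sum.
move=> x v /hM [a ha ->].
have -> : rho (\sum_(i < size es) a i *: es`_i) v =
    \sum_(i < size es) (a i)%:C%C *: rho (es`_i) v.
  have [_ hl _] := rep_lie rho.
  apply: (big_rec2 (fun x u => rho x v = u)) => [|i u x' _ <-]; last by rewrite hl.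
  by rewrite -(scale0r 0) rho_scale scale0r.
rewrite (big_nth 0) big_mkord mulr_sumr.
elim: (size es) => [|n IH]; first by rewrite !big_ord0 (seminorm0 hq.1).
rewrite !big_ord_recr /=; apply: le_trans (seminormD hq.1 _ _) _.
apply: lerD => //; rewrite (seminormZr hq.1).
by apply: ler_wpM2r => //; apply: seminorm_ge0 hq.1 _.
Qed.

(** Moving [x] to the left past a letter [y] replaces [y x] by [x y] and a
    commutator, so that the bound is multiplied by [1 + c r <= 2] per letter of
    weight [r]. *)
Lemma word_commute (c r : R) q q' : seminorm q -> seminorm q' -> 0 < c ->
  (forall x y, B x -> B y -> B (c^-1 *: lie x y)) ->
  (forall x v, B x -> q (rho x v) <= q' v) -> 0 <= r -> c * r <= 1 ->
  forall xs x v P, word_bound r q' v P -> B x -> ball_word xs ->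
    r ^+ size xs * q (act xs (rho x v)) <= 2 ^+ size xs * P.
Proof.
move=> hq hq' c0 hc hqq r0 cr; elim/last_ind => [|xs y IH] x v P hv hx hxs.
  by rewrite !mul1r; apply: le_trans (hqq _ _ hx) _; have := hv _ ball_word_nil; rewrite mul1r.
have [hxs' hy] := ball_word_rconsP hxs; have P0 := word_bound_ge0 hq' hv.
rewrite size_rcons act_rcons.
have [->|rn0] := eqVneq r 0; first by rewrite expr0n mul0r mulr_ge0.
have rp : 0 < r by rewrite lt_neqAle eq_sym rn0.
have h1 := IH x _ _ (word_bound_rho rp hy hv) hx hxs'.
have h2 := IH _ _ _ hv (hc _ _ hy hx) hxs'.
rewrite rho_lie (linD (act_linear xs)) (rho_rescale (lie y x) _ c0).
rewrite (linZ (act_linear xs)).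
set X := act xs _ in h1 *; set Y := act xs _ in h2 *.
have h3 : q (X + c%:C%C *: Y) <= q X + c * q Y.
  by apply: le_trans (seminormD hq _ _) _; rewrite seminormZr // gtr0_norm.
apply: le_trans (ler_wpM2l (exprn_ge0 _ r0) h3) _.
have -> : r ^+ (size xs).+1 * (q X + c * q Y) =
    r * (r ^+ size xs * q X) + c * r * (r ^+ size xs * q Y) by rewrite exprS; ring.
have -> : 2 ^+ (size xs).+1 * P = r * (2 ^+ size xs * (P / r)) + 1 * (2 ^+ size xs * P).
  by rewrite exprS; field.
apply: lerD; first by rewrite ler_wpM2l.
by apply: ler_pM; rewrite ?mulr_ge0 ?exprn_ge0 ?(ltW c0) ?(seminorm_ge0 hq).
Qed.

Definition uniformly_bounded q (u : uea g) q' (t D r0 : R) := forall v r P,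
  0 <= r <= r0 -> word_bound (t * r) q' v P -> word_bound r q (uact rho u v) (D * P).

(** The constants do not depend on the radius, down to radius zero; the price
    is a change of seminorm and of the radius by a constant factor. *)
Lemma uact_uniformly_bounded q (u : uea g) : cs V q ->
  exists q' t D r0, [/\ cs V q', 0 < t, 0 <= D & 0 < r0] /\
    uniformly_bounded q u q' t D r0.
Proof.
have hr := rep_lie rho.
elim/quotW: u q => a q hq.
suff [q' [t [D [r0 [h1 h2]]]]] : exists q' t D r0,
    [/\ cs V q', 0 < t, 0 <= D & 0 < r0] /\ forall v r P, 0 <= r <= r0 ->
      word_bound (t * r) q' v P -> word_bound r q (uev rho a v) (D * P).
  by exists q', t, D, r0; split=> // v r P hrr hv; rewrite uact_pi //; apply: h2.
elim: a q hq => [x||a IHa b IHb|k a IHa|a IHa b IHb] q hq /=.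
- have [q' hq' hqq] := cs_ball hq; have [c c0 hc] := B_br.
  have [M M0 hM] := B_abs x.
  exists q', 2, M, (2 * c)^-1; split; first by split; rewrite ?ltW ?invr_gt0 ?mulr_gt0.
  move=> v r P /andP[r0 rc] hv; rewrite (rho_rescale x _ M0).
  rewrite -[M in M * P]gtr0_norm // -normc_real; apply: (word_bound_scale _ hq.1) => xs hxs.
  have r20 : 0 <= 2 * r by rewrite mulr_ge0.
  have cr : c * (2 * r) <= 1.
    by rewrite mulrCA mulrA -ler_pdivlMl ?mulr_gt0 // mulr1.
  have := word_commute hq.1 hq'.1 c0 hc hqq r20 cr hv hM hxs.
  by rewrite exprMn -mulrA ler_pM2l // exprn_gt0.
- by exists q, 1, 1, 1; split=> // v r P _; rewrite !mul1r.
- have [q1 [t1 [D1 [r1 [[hq1 ht1 hD1 hr1] h1]]]]] := IHa q hq.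
  have [q2 [t2 [D2 [r2 [[hq2 ht2 hD2 hr2] h2]]]]] := IHb q hq.
  exists (fun v => q1 v + q2 v), (t1 + t2), (D1 + D2), (Num.min r1 r2); split.
    by split; rewrite ?addr_gt0 ?addr_ge0 ?lt_min ?hr1 //; apply: csD.
  move=> v r P /andP[r0]; rewrite le_min => /andP[rr1 rr2] hv; rewrite mulrDl.
  apply: (word_bound_add hq.1 r0).
    apply: h1; first by rewrite r0.
    apply: (word_bound_mono hq1.1 _ _ hv) => [|u]; last by rewrite lerDl (seminorm_ge0 hq2.1).
    by rewrite mulr_ge0 ?(ltW ht1) //= ler_wpM2r // lerDl ltW.
  apply: h2; first by rewrite r0.
  apply: (word_bound_mono hq2.1 _ _ hv) => [|u]; last by rewrite lerDr (seminorm_ge0 hq1.1).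
  by rewrite mulr_ge0 ?(ltW ht2) //= ler_wpM2r // lerDr ltW.
- have [q1 [t1 [D1 [r1 [[hq1 ht1 hD1 hr1] h1]]]]] := IHa q hq.
  exists q1, t1, (normc k * D1), r1; split; first by rewrite mulr_ge0 ?normc_ge0.
  by move=> v r P hrr hv; rewrite -mulrA; apply: (word_bound_scale _ hq.1); apply: h1.
- have [q1 [t1 [D1 [r1 [[hq1 ht1 hD1 hr1] h1]]]]] := IHa q hq.
  have [q2 [t2 [D2 [r2 [[hq2 ht2 hD2 hr2] h2]]]]] := IHb q1 hq1.
  exists q2, (t2 * t1), (D1 * D2), (Num.min r1 (r2 / t1)); split.
    by split; rewrite ?mulr_gt0 ?mulr_ge0 ?lt_min ?hr1 ?divr_gt0.
  move=> v r P /andP[r0]; rewrite le_min => /andP[rr1 rr2]; rewrite -!mulrA => hv.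
  apply: h1; first by rewrite r0.
  apply: h2 => //; rewrite mulr_ge0 ?(ltW ht1) //=.
  by rewrite mulrC -ler_pdivlMr.
Qed.

Lemma uniformly_bounded_mono q u q1 q2 t1 t2 D1 D2 r1 r2 :
  seminorm q -> seminorm q1 -> (forall v, q1 v <= q2 v) -> 0 <= t1 <= t2 -> D1 <= D2 ->
  r2 <= r1 ->
  uniformly_bounded q u q1 t1 D1 r1 -> uniformly_bounded q u q2 t2 D2 r2.
Proof.
move=> hq hq1 hqq /andP[t0 tt] hD hr h v r P /andP[r0 rr] hv.
have hv1 : word_bound (t1 * r) q1 v P.
  by apply: (word_bound_mono hq1 _ hqq hv); rewrite mulr_ge0 //= ler_wpM2r.
have P0 := word_bound_ge0 hq1 hv1.
move=> xs hxs; apply: le_trans (h v r P _ hv1 xs hxs) _; last by rewrite ler_wpM2r.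
by rewrite r0 (le_trans rr).
Qed.

Lemma uact_uniformly_bounded_seq q (us : seq (uea g)) : cs V q ->
  exists q' t D r0, [/\ cs V q', 0 < t, 0 <= D & 0 < r0] /\
    forall u, u \in us -> uniformly_bounded q u q' t D r0.
Proof.
move=> hq; elim: us => [|u us [q1 [t1 [D1 [r1 [[hq1 ht1 hD1 hr1] h1]]]]]].
  by exists q, 1, 1, 1.
have [q2 [t2 [D2 [r2 [[hq2 ht2 hD2 hr2] h2]]]]] := uact_uniformly_bounded u hq.
exists (fun v => q1 v + q2 v), (t1 + t2), (D1 + D2), (Num.min r1 r2); split.
  by split; rewrite ?addr_gt0 ?addr_ge0 ?lt_min ?hr1 //; apply: csD.
move=> u'; rewrite inE => /orP[/eqP ->|/h1].
  apply: (uniformly_bounded_mono hq.1 hq2.1 _ _ _ _ h2).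
  - by move=> v; rewrite lerDr (seminorm_ge0 hq1.1).
  - by rewrite (ltW ht2) lerDr ltW.
  - by rewrite lerDr.
  - by rewrite ge_min lexx orbT.
move=> h; apply: (uniformly_bounded_mono hq.1 hq1.1 _ _ _ _ h).
- by move=> v; rewrite lerDl (seminorm_ge0 hq2.1).
- by rewrite (ltW ht1) lerDl ltW.
- by rewrite lerDl.
- by rewrite ge_min lexx.
Qed.

(** * Termwise bounds and the seminorms of order one *)

Lemma uact_word xs v : uact rho (\prod_(x <- xs) uin x) v = act xs v.
Proof.
have hr := rep_lie rho; elim: xs => [|x xs IH]; first by rewrite big_nil uact1.
by rewrite big_cons uactM // uact_in // IH.
Qed.

(** The supremum in the definition of [p_{r,q}]. *)
Definition word_sup q n v : \bar R :=
  ereal_sup [set (q (uact rho (\prod_(i < n) uin (xi i)) v))%:E |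
                xi in [set xi : 'I_n -> g | forall i, B (xi i)]].

Lemma pnorm1E r q v : pnorm B rho 1 r q v = (\sum_(0 <= n <oo) ((r ^+ n)%:E * word_sup q n v))%E.
Proof.
rewrite /pnorm; congr (limn _); apply/funext => k.
by apply: eq_bigr => n _; rewrite subrr powRr0 mul1r.
Qed.

Lemma word_sup_ub q xs v : ball_word xs -> ((q (act xs v))%:E <= word_sup q (size xs) v)%E.
Proof.
move=> hxs; apply: ereal_sup_ubound; exists (tnth (in_tuple xs)).
  by move=> i; apply/hxs/mem_tnth.
by rewrite -uact_word [in RHS]big_tnth.
Qed.

Lemma word_sup_le q n v (M : \bar R) :
  (forall xs, size xs = n -> ball_word xs -> ((q (act xs v))%:E <= M)%E) ->
  (word_sup q n v <= M)%E.
Proof.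
move=> h; apply: ge_ereal_sup => _ [xi hxi <-].
have -> : \prod_(i < n) uin (xi i) = \prod_(x <- [seq xi i | i <- enum 'I_n]) uin x.
  by rewrite big_map enumT [index_enum _]unlock.
rewrite uact_word; apply: h; first by rewrite size_map size_enum_ord.
by move=> _ /mapP[i _ ->].
Qed.

Lemma ball0 : B 0.
Proof. by have [M _] := B_abs 0; rewrite scaler0. Qed.

Lemma word_sup_ge0 q n v : seminorm q -> (0 <= word_sup q n v)%E.
Proof.
move=> hq; apply: (@le_trans _ _ (q (act (nseq n 0) v))%:E).
  by rewrite lee_fin seminorm_ge0.
rewrite -[in word_sup q n v](size_nseq n (0 : g)); apply: word_sup_ub => x.
by rewrite mem_nseq => /andP[_ /eqP ->]; apply: ball0.
Qed.

Lemma pnorm_term_ge0 r q v n : seminorm q -> 0 <= r -> (0 <= (r ^+ n)%:E * word_sup q n v)%E.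
Proof. by move=> hq r0; rewrite mule_ge0 ?word_sup_ge0 // lee_fin exprn_ge0. Qed.

Lemma pnorm_ge0 r q v : seminorm q -> 0 <= r -> (0 <= pnorm B rho 1 r q v)%E.
Proof.
by move=> hq r0; rewrite pnorm1E; apply: nneseries_ge0 => n _ _; apply: pnorm_term_ge0.
Qed.

Lemma word_bound_of_pnorm r q v P : seminorm q -> 0 <= r ->
  (pnorm B rho 1 r q v <= P%:E)%E -> word_bound r q v P.
Proof.
move=> hq r0; rewrite pnorm1E => h xs hxs; rewrite -lee_fin; apply: le_trans h.
set f := (X in (_ <= \sum_(0 <= n <oo) X n)%E).
have := @nneseries_lim_ge R f xpredT 0 (size xs).+1 (fun n _ _ => pnorm_term_ge0 v n hq r0).
apply: le_trans; rewrite big_nat_recr //= -[leLHS]add0e; apply: leeD.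
  by apply: sume_ge0 => n _; apply: pnorm_term_ge0.
by rewrite EFinM lee_pmul ?lee_fin ?exprn_ge0 ?seminorm_ge0 ?word_sup_ub.
Qed.

Lemma word_bound_fine r q v : seminorm q -> 0 <= r -> (pnorm B rho 1 r q v < +oo)%E ->
  exists2 P, pnorm B rho 1 r q v = P%:E & word_bound r q v P.
Proof.
move=> hq r0 hf; have := pnorm_ge0 v hq r0.
case E : (pnorm B rho 1 r q v) hf => [P| |] // _ _.
by exists P => //; apply: word_bound_of_pnorm; rewrite ?E.
Qed.

Lemma geometric_sum_le (th : R) n : 0 <= th < 1 ->
  \sum_(0 <= k < n) th ^+ k <= (1 - th)^-1.
Proof.
move=> /andP[t0 t1]; have h : 0 < 1 - th by rewrite subr_gt0.
rewrite -[leRHS]mul1r ler_pdivlMr // big_mkord mulrC.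
have := subrX1 th n; rewrite -(opprB 1 th) mulNr -(opprB 1 (th ^+ n)) => /oppr_inj <-.
by rewrite gerBl exprn_ge0.
Qed.

(** A termwise bound at radius [r] dominates the series at radius [th * r] by a
    geometric one.  The form [th * r] includes [r = 0]. *)
Lemma pnorm_of_word_bound r th q v P : seminorm q -> 0 <= r -> 0 <= th < 1 ->
  word_bound r q v P -> (pnorm B rho 1 (th * r) q v <= (P / (1 - th))%:E)%E.
Proof.
move=> hq r0 hth hv; have [t0 t1] := andP hth; have P0 := word_bound_ge0 hq hv.
have tr0 : 0 <= th * r by rewrite mulr_ge0.
rewrite pnorm1E; apply: lime_le.
  by apply: is_cvg_nneseries => n _ _; apply: pnorm_term_ge0.
apply: nearW => n; apply: (@le_trans _ _ (\sum_(0 <= k < n) (P * th ^+ k)%:E)%E).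
  apply: lee_sum => k _.
  have [r0'|rn0] := eqVneq (r ^+ k) 0.
    by rewrite exprMn r0' mulr0 mul0e lee_fin mulr_ge0 // exprn_ge0.
  have rk : 0 < r ^+ k by rewrite lt_neqAle eq_sym rn0 exprn_ge0.
  have hs : (word_sup q k v <= (P / r ^+ k)%:E)%E.
    apply: word_sup_le => xs sxs hxs; rewrite lee_fin ler_pdivlMr // mulrC -sxs.
    exact: hv.
  have -> : P * th ^+ k = (th * r) ^+ k * (P / r ^+ k) by rewrite exprMn; field.
  by rewrite EFinM; apply: lee_pmul; rewrite ?word_sup_ge0 ?lee_fin ?exprn_ge0.
rewrite sumEFin lee_fin -mulr_sumr ler_wpM2l //.
exact: geometric_sum_le.
Qed.

Lemma analytic_word_bound r0 q r v : analytic B rho 1 r0 v -> cs V q -> 0 <= r < r0 ->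
  exists2 P, pnorm B rho 1 r q v = P%:E & word_bound r q v P.
Proof.
move=> hv hq hr; apply: word_bound_fine; first exact: hq.1.
  by case/andP: hr.
exact: hv.
Qed.

(** Analyticity survives the loss of radius in [pnorm_of_word_bound] because its
    interval of radii is open. *)
Lemma analytic_uact r0 u v : analytic B rho 1 r0 v -> analytic B rho 1 r0 (uact rho u v).
Proof.
move=> hv q r hq /andP[rge0 rr0].
(* a word bound at a larger radius makes the series at [r] geometric *)
pose r1 := (r + r0) / 2.
have [r10 rr1 r1r0] : [/\ 0 < r1, r < r1 & r1 < r0] by rewrite /r1; split; lra.
have [P _ hP] : exists2 P, pnorm B rho 1 r1 q v = P%:E & word_bound r1 q v P.
  by apply: analytic_word_bound hv hq _; rewrite ltW.
have [D D0 hD] := word_bound_uact u hq.1 r10.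
have := @pnorm_of_word_bound r1 (r / r1) _ _ _ hq.1 (ltW r10) _ (hD _ _ hP).
rewrite divfK ?gt_eqF // => /(_ _)/le_lt_trans; apply; last exact: ltry.
by rewrite divr_ge0 ?(ltW r10) //= ltr_pdivrMr // mul1r.
Qed.

Lemma entire_uact u v : entire B rho 1 v -> entire B rho 1 (uact rho u v).
Proof. by move=> hv r0 hr0; apply/analytic_uact/hv. Qed.

Lemma pnorm_eigen0 r0 q (D : g) (M k r : R) (b : uea g) w :
  seminorm q -> 0 < r0 -> 0 < M -> B (M^-1 *: D) -> 2 * M < k * r0 ->
  ad_eigen D k b -> (exists P, word_bound r0 q w P) ->
  0 <= r -> pnorm B rho 1 r q (uact rho b w) = 0%E.
Proof.
move=> hq r00 M0 hD hk hb [P hP] r_ge0.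
have h : word_bound (r + r) q (uact rho b w) 0.
  by move=> xs hxs; rewrite (eigen_vanish hq r00 M0 hD hk hb hP hxs) mulr0.
have := pnorm_of_word_bound (th := 2^-1) hq (addr_ge0 r_ge0 r_ge0) _ h.
have -> : 2^-1 * (r + r) = r by field.
rewrite mul0r => /(_ _) hle; apply: le_anti; rewrite pnorm_ge0 // andbT; apply: hle.
lra.
Qed.
End OneRep.

(** * Tensors *)

Section TwoReps.
Variables (V W : tvsType C) (rhoV : rep g V) (rhoW : rep g W).

Lemma ptens_le_sum (A : set V) (A' : set W) (p : V -> \bar R) (p' : W -> \bar R)
    (I : eqType) (s : seq I) (f : I -> V) (f' : I -> W) z :
  z = \sum_(i <- s) tens (f i) (f' i) ->
  (forall i, i \in s -> A (f i)) -> (forall i, i \in s -> A' (f' i)) ->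
  (ptens A A' p p' z <= \sum_(i <- s) p (f i) * p' (f' i))%E.
Proof.
move=> -> hA hA'; apply: ereal_inf_lbound; exists [seq (f i, f' i) | i <- s].
  split; last by rewrite big_map.
  by move=> _ /mapP[i si ->]; split; [apply: hA | apply: hA'].
by rewrite big_map.
Qed.

Lemma uact2_linear z : linear (fun F => uact2 rhoV rhoW F z).
Proof.
have hV := rep_lie rhoV; have hW := rep_lie rhoW.
apply: tlift_linear; split=> [b|a]; apply: tlift_param => v w k u u'; rewrite uact_lin //.
- exact: (tens_bilin _ _).1.
- exact: (tens_bilin _ _).2.
Qed.

Lemma uact2_sum (s : seq (uea g * uea g)) k v w :
  uact2 rhoV rhoW (k *: \sum_(x <- s) tens x.1 x.2) (tens v w) =
  \sum_(x <- s) tens (uact rhoV (k *: x.1) v) (uact rhoW x.2 w).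
Proof.
rewrite scaler_sumr (lin_sum (uact2_linear _)); apply: eq_bigr => x _.
rewrite -(linZ ((tens_bilin _ _).1 x.2)) uact2_tens //; exact: rep_lie.
Qed.

(** [F] itself is not claimed to act by zero: only the seminorms of the
    second factors vanish, which suffices whatever the first factors are. *)
Lemma ptens_right_eigen (A : set V) (A' : set W) (D : g) (M k r r0 : R) F
    (a : C) qV qW v w :
  (forall u, A (uact rhoV u v)) -> (forall u, A' (uact rhoW u w)) ->
  seminorm qW -> 0 < r0 -> 0 < M -> B (M^-1 *: D) -> 2 * M < k * r0 ->
  right_eigen D k F -> (exists P, word_bound rhoW r0 qW w P) -> 0 <= r ->
  (ptens A A' (pnorm B rhoV 1 r qV) (pnorm B rhoW 1 r qW)
    (uact2 rhoV rhoW (a *: F) (tens v w)) <= 0)%E.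
Proof.
move=> hA hA' hq r00 M0 hD hk [s -> hs] hw r_ge0; rewrite uact2_sum.
apply: le_trans (ptens_le_sum _ _ (erefl _) _ _) _ => //.
rewrite big_seq big1 // => x xs.
by rewrite (pnorm_eigen0 hq r00 M0 hD hk (hs x xs) hw r_ge0) mule0.
Qed.

(** One choice of seminorms and constants serves finitely many tensors and all
    scalars of bounded modulus. *)
Lemma ptens_small_radius (Fs : seq (tensor (uea g) (uea g))) qV qW (C0 : R) :
  cs V qV -> cs W qW -> 0 <= C0 ->
  exists qV' qW' t D r0, [/\ cs V qV', cs W qW', 0 < t, 0 < D & 0 < r0] /\
    forall F (a : C) (A : set V) (A' : set W) r v w P Q, F \in Fs -> normc a <= C0 ->
    0 <= r <= r0 -> (forall u, A (uact rhoV u v)) -> (forall u, A' (uact rhoW u w)) ->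
    word_bound rhoV (t * r) qV' v P -> word_bound rhoW (t * r) qW' w Q ->
    (ptens A A' (pnorm B rhoV 1 r qV) (pnorm B rhoW 1 r qW)
      (uact2 rhoV rhoW (a *: F) (tens v w)) <= (D * P * Q)%:E)%E.
Proof.
move=> hqV hqW C00.
pose us := flatten [seq repr F | F <- Fs].
have [qV' [t1 [D1 [r1 [[hV ht1 hD1 hr1] h1]]]]] :=
  uact_uniformly_bounded_seq rhoV (unzip1 us) hqV.
have [qW' [t2 [D2 [r2 [[hW ht2 hD2 hr2] h2]]]]] :=
  uact_uniformly_bounded_seq rhoW (unzip2 us) hqW.
pose E : R := 4 * C0 * D1 * D2.
have E0 : 0 <= E by rewrite !mulr_ge0.
(* the factor 2 in the radius pays for summing the series, with [th = 1/2] *)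
exists qV', qW', (2 * (t1 + t2)), ((size us)%:R * E + 1), (Num.min r1 r2 / 2).
split.
  split=> //; first by rewrite mulr_gt0 // addr_gt0.
  - by rewrite ltr_wpDl // mulr_ge0.
  - by rewrite divr_gt0 // lt_min hr1.
move=> F a A A' r v w P Q hF ha /andP[r_ge0 rle] hA hA' hP hQ.
have P0 := word_bound_ge0 hV.1 hP; have Q0 := word_bound_ge0 hW.1 hQ.
have r2_ge0 : 0 <= 2 * r by rewrite mulr_ge0.
move: rle; rewrite ler_pdivlMr // mulrC le_min => /andP[rle1 rle2].
have half : 2^-1 * (2 * r) = r by field.
have th : 0 <= (2^-1 : R) < 1 by lra.
rewrite [F in a *: F]tensorE uact2_sum.
apply: le_trans (ptens_le_sum _ _ (erefl _) _ _) _ => //.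
have sub x : x \in repr F -> x \in us.
  by move=> hx; apply/flattenP; exists (repr F) => //; apply: map_f.
have hx x : x \in repr F -> (pnorm B rhoV 1 r qV (uact rhoV (a *: x.1) v) *
    pnorm B rhoW 1 r qW (uact rhoW x.2 w) <= (E * P * Q)%:E)%E.
  move=> /sub xs.
  have hP' : word_bound rhoV (t1 * (2 * r)) qV' v P.
    apply: (word_bound_mono hV.1 _ _ hP) => //; rewrite mulr_ge0 ?(ltW ht1) //=.
    rewrite mulrCA -mulrA ler_pM2l // ler_wpM2r // lerDl ltW //.
  have hQ' : word_bound rhoW (t2 * (2 * r)) qW' w Q.
    apply: (word_bound_mono hW.1 _ _ hQ) => //; rewrite mulr_ge0 ?(ltW ht2) //=.
    by rewrite mulrCA -mulrA ler_pM2l // ler_wpM2r // lerDr ltW.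
  have b1 := h1 _ (map_f _ xs) v (2 * r) P _ hP'.
  have b2 := h2 _ (map_f _ xs) w (2 * r) Q _ hQ'.
  have c1 := word_bound_scale a hqV.1 (b1 _).
  have d1 := pnorm_of_word_bound hqV.1 r2_ge0 th (c1 _).
  have d2 := pnorm_of_word_bound hqW.1 r2_ge0 th (b2 _).
  rewrite half in d1 d2.
  have -> : uact rhoV (a *: x.1) v = a *: uact rhoV x.1 v.
    exact: (linZ (uact_lin (rep_lie rhoV) v)).
  apply: le_trans (lee_pmul _ _ (d1 _) (d2 _)) _; rewrite ?pnorm_ge0 ?r2_ge0 //.
  - exact: hqV.1.
  - exact: hqW.1.
  rewrite -EFinM lee_fin.
  have -> : normc a * (D1 * P) / (1 - 2^-1) * (D2 * Q / (1 - 2^-1)) =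
     normc a * (4 * D1 * D2 * P * Q) by field.
  have -> : E * P * Q = C0 * (4 * D1 * D2 * P * Q) by rewrite /E; ring.
  by rewrite ler_wpM2r // !mulr_ge0.
rewrite big_seq; apply: le_trans (lee_sum _ hx) _.
rewrite -big_seq sumEFin lee_fin big_const_seq count_predT iter_addr_0 -[X in X <= _]mulr_natl.
have -> : (size (repr F))%:R * (E * P * Q) = (size (repr F))%:R * E * (P * Q) by ring.
have -> : ((size us)%:R * E + 1) * P * Q = ((size us)%:R * E + 1) * (P * Q) by ring.
rewrite ler_wpM2r ?mulr_ge0 // ler_wpDr // ler_wpM2r // ler_nat.
rewrite /us size_flatten /shape -map_comp.
elim: Fs hF {us h1 h2 sub hx} => [//|G Fs IH]; rewrite inE => /orP[/eqP <-|/IH h] /=.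
  exact: leq_addr.
exact: leq_trans h (leq_addl _ _).
Qed.

End TwoReps.
End Words.

(** * The Lie algebra and its unit ball *)

Section CalH.
Variables (R : realType) (d : nat).
Local Notation C := R[i].
Local Notation B := (@calH_ball R d).

Lemma calH_ballP (x : calH R d) : B x <-> \sum_i \sum_j (val x i j) ^+ 2 < 1.
Proof.
by rewrite /calH_ball /= -[X in _ < X]sqrtr1 ltr_sqrt.
Qed.

Lemma calH_ball_entry (x : calH R d) i j : B x -> `|val x i j| <= 1.
Proof.
move=> /calH_ballP h; rewrite -(@ler_pXn2r _ 2) ?nnegrE // expr1n real_normK ?num_real //.
apply: le_trans (ltW h); rewrite (bigD1 i) //= (bigD1 j) //= -addrA lerDl.
by rewrite addr_ge0 ?sumr_ge0 // => k _; rewrite ?sumr_ge0 ?sqr_ge0 // => l _; apply: sqr_ge0.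
Qed.

Lemma calH_ball_of_entries (M : R) (x : calH R d) : 0 <= M ->
  (forall i j, `|val x i j| <= M) -> B ((M * d%:R + 1)^-1 *: x).
Proof.
move=> M0 h; set K := M * _ + 1.
have Md : 0 <= M * d%:R by rewrite mulr_ge0.
have K0 : 0 < K by rewrite ltr_wpDl.
apply/calH_ballP; apply: (@le_lt_trans _ _ (\sum_(i < d) \sum_(j < d) (M / K) ^+ 2)).
  apply: ler_sum => i _; apply: ler_sum => j _.
  rewrite /= !mxE exprMn exprMn mulrC ler_wpM2r ?sqr_ge0 //.
  rewrite -[X in X <= _]real_normK ?num_real //.
  by apply: lerXn2r; rewrite ?nnegrE.
rewrite !sumr_const card_ord -mulrnA -mulr_natl natrM -expr2 -exprMn mulrA.
rewrite expr_lt1 ?ltr_pdivrMr ?mul1r //; last by rewrite divr_ge0 ?(ltW K0) // mulr_ge0.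
by rewrite mulrC ltrDl.
Qed.

Lemma calH_ball_abs (x : calH R d) : exists2 M : R, 0 < M & B (M^-1 *: x).
Proof.
pose M := \sum_i \sum_j `|val x i j|.
have M0 : 0 <= M by apply: sumr_ge0 => i _; apply: sumr_ge0.
exists (M * d%:R + 1); first by rewrite ltr_wpDl // mulr_ge0.
apply: calH_ball_of_entries => // i j.
rewrite /M (bigD1 i) //= (bigD1 j) //= -addrA lerDl addr_ge0 ?sumr_ge0 //.
by move=> k _; rewrite sumr_ge0.
Qed.

Lemma calH_ball_lie : exists2 c : R, 0 < c &
  forall x y : calH R d, B x -> B y -> B (c^-1 *: lie x y).
Proof.
exists ((d%:R + d%:R) * d%:R + 1); first by rewrite ltr_wpDl // mulr_ge0 ?addr_ge0.
move=> x y hx hy; apply: calH_ball_of_entries => [|i j]; first by rewrite addr_ge0.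
have h (a b : calH R d) : B a -> B b -> `|(val a *m val b) i j| <= d%:R.
  move=> ha hb; rewrite mxE; apply: le_trans (ler_norm_sum _ _ _) _.
  have -> : d%:R = \sum_(k < d) (1 : R) by rewrite sumr_const card_ord.
  apply: ler_sum => k _; rewrite normrM -[leRHS]mulr1.
  by apply: ler_pM => //; apply: calH_ball_entry.
rewrite /= !mxE; apply: le_trans (ler_normB _ _) _.
by have := lerD (h x y hx hy) (h y x hy hx); rewrite !mxE.
Qed.

(** A maximal free family in the Lie algebra is a basis; its coordinates are
    linear on the whole matrix space, hence bounded on the ball. *)
Lemma calH_ball_fin : exists (es : seq (calH R d)) (M : R), 0 <= M /\
  forall x, B x -> exists2 a : nat -> R, (forall i, `|a i| <= M) &
    x = \sum_(i < size es) a i *: es`_i.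
Proof.
pose Pn n := `[< exists2 es : seq (calH R d), size es = n &
  free [seq val e : 'M[R]_d | e <- es] >].
have ex0 : exists n, Pn n by exists 0%N; apply/asboolP; exists [::] => //; apply: nil_free.
have bd n : Pn n -> (n <= \dim {: 'M[R]_d})%N.
  move=> /asboolP[es <-]; rewrite -(size_map val) /free => /eqP <-.
  by apply/dimvS/subvf.
have [n /asboolP[es sz fr] nmax] := ex_maxnP ex0 bd.
pose ms := [seq val e : 'M[R]_d | e <- es].
have span (x : calH R d) : val x \in <<ms>>%VS.
  apply/negPn/negP => nx.
  have : Pn n.+1 by apply/asboolP; exists (x :: es); rewrite /= ?sz // free_cons nx fr.
  by move=> /nmax; rewrite ltnn.
pose X := in_tuple ms.
pose a (A : 'M[R]_d) (i : nat) : R := if insub i is Some k then coord X k A else 0.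
(* [M] bounds all coordinates of all matrices with entries of modulus at most 1 *)
pose M := \sum_k \sum_i \sum_j `|coord X k (delta_mx i j)|.
have M0 : 0 <= M by do 3 (apply: sumr_ge0 => ? _).
exists es, M; split=> // x hx; exists (a (val x)) => [i|].
  rewrite /a; case: insubP => [k _ _|_]; last by rewrite normr0.
  rewrite (matrix_sum_delta (val x)) !linear_sum /=.
  apply: (@le_trans _ _ (\sum_i \sum_j `|coord X k (delta_mx i j)|)).
    apply: le_trans (ler_norm_sum _ _ _) _; apply: ler_sum => i' _.
    rewrite linear_sum; apply: le_trans (ler_norm_sum _ _ _) _; apply: ler_sum => j _.
    by rewrite linearZ /= normrM ler_piMl // calH_ball_entry.
  rewrite /M [X in _ <= X](bigD1 k) //= lerDl.
  by do 3 (apply: sumr_ge0 => ? _).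
apply: val_inj; rewrite [LHS](coord_span (X := X)) ?span //=.
have -> : \sum_i coord X i (val x) *: X`_i = \sum_(i < size ms) a (val x) i *: ms`_i.
  apply: eq_bigr => k _; congr (_ *: _); rewrite /a.
  by rewrite (valK k).
rewrite (big_morph val (id1 := 0) (op1 := +%R)) // size_map.
by apply: eq_bigr => k _; rewrite /= (nth_map 0).
Qed.

End CalH.

(** * The grading of the twist *)

Section TwistGrading.
Variables (R : realType) (d : nat).
Local Notation C := R[i].
Local Notation E := (munit R d).

Lemma munitM a b b' e : E a b *m E b' e = ((b == b') && (0 < b <= d))%N%:R *: E a e.
Proof.
apply/matrixP => i j; rewrite !mxE.
have [hb|hb] := boolP (0 < b <= d)%N; last first.
  rewrite andbF mul0r big1 // => k _; rewrite !mxE.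
  case: eqP => [_|_] /=; last by rewrite mul0r.
  case: eqP => [hk|_] /=; last by rewrite mul0r.
  by case/negP: hb; rewrite -hk ltn_ord.
have hb' : (b.-1 < d)%N by case/andP: hb => b0 bd; rewrite prednK.
rewrite andbT (bigD1 (Ordinal hb')) //= big1 ?addr0.
  rewrite !mxE /= prednK ?eqxx ?andbT; last by case/andP: hb.
  by case: (i.+1 == a); case: (b == b'); case: (j.+1 == e); rewrite ?mulr0 ?mulr1.
move=> k /eqP nk; rewrite !mxE; case: (k.+1 =P b) => [hk|_]; last by rewrite andbF mul0r.
by case: nk; apply: val_inj; rewrite /= -hk.
Qed.

(** The diagonal matrix [diag (1, ..., 1, 1 - d)], for which every [E s d]
    with [s < d] is an eigenvector of the same positive eigenvalue [d]. *)
Definition grading : calH R d := \sum_(1 <= n < d) n%:R *: inH (mH R d n).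

Lemma val_grading : (0 < d)%N ->
  val grading = \sum_(1 <= n < d) E n n - (d.-1)%:R *: E d d.
Proof.
move=> d0.
have -> : val grading = \sum_(1 <= n < d) n%:R *: mH R d n.
  rewrite (big_morph val (id1 := 0) (op1 := +%R)) // !big_nat; apply: eq_bigr => n hn.
  rewrite /= inH_gen //; apply: Or31; exists n => //.
  by case/andP: hn => n1 nd; rewrite n1 -ltnS prednK.
(* summation by parts *)
have h k : \sum_(1 <= n < k.+1) n%:R *: mH R d n =
    \sum_(1 <= n < k.+1) E n n - k%:R *: E k.+1 k.+1.
  elim: k => [|k IH]; first by rewrite !big_geq // scale0r subrr.
  rewrite big_nat_recr // IH [in RHS]big_nat_recr //= /mH scalerBr -natr1.
  by rewrite !scalerDl !scale1r -!addrA addKr.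
by have := h d.-1; rewrite prednK.
Qed.

Lemma grading_eigen s : (0 < s < d)%N ->
  lie grading (inH (E s d)) = d%:R *: inH (E s d).
Proof.
move=> /andP[s0 sd]; have d0 : (0 < d)%N by apply: leq_trans sd.
apply: val_inj => /=; rewrite /mlie inH_gen; last first.
  by apply: Or33; exists s => //; rewrite s0 -ltnS prednK.
rewrite [calH_val _]val_grading //.
rewrite mulmxBl mulmxBr -scalemxAl -scalemxAr !munitM (gtn_eqF sd) eqxx d0 leqnn.
have -> : (\sum_(1 <= n < d) E n n) *m E s d = E s d.
  rewrite mulmx_suml (bigD1_seq s) ?iota_uniq ?mem_index_iota ?s0 //=.
  rewrite munitM eqxx s0 (ltnW sd) scale1r big1 ?addr0 // => n ns.
  by rewrite munitM (negPf ns) scale0r.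
have -> : E s d *m (\sum_(1 <= n < d) E n n) = 0.
  rewrite mulmx_sumr big_nat big1 // => n /andP[_ nd].
  by rewrite munitM (gtn_eqF nd) scale0r.
rewrite scale0r scaler0 subr0 sub0r opprK scale1r -{1}[E s d]scale1r -scalerDl.
by rewrite addrC natr1 prednK.
Qed.

Lemma uE_eigen s : (0 < s < d)%N -> ad_eigen grading d%:R (uE R d s d).
Proof. by move=> hs; apply/ad_eigen_uin/grading_eigen. Qed.

(** Every monomial of [F n] has exactly [n] factors [E s d] on the right. *)
Lemma twF_eigen (c : nat -> C) n : (2 <= d)%N ->
  right_eigen grading (n%:R * d%:R) (twF d c n).
Proof.
move=> d2; rewrite /twF -big_enum; apply: right_eigen_sum => m _; apply: right_eigenMn.
have mn : (m <= n)%N by rewrite -ltnS.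
rewrite -{1}(subnKC mn) natrD mulrDl; apply: right_eigenM.
  apply: right_eigenX; apply: right_eigen_sum => s; rewrite mem_index_iota => /andP[s2 sd].
  by apply/right_eigen_tens/uE_eigen; rewrite sd (leq_trans _ s2).
by apply/right_eigen_tens/ad_eigenX/uE_eigen.
Qed.

Lemma twF0 (c : nat -> C) : twF d c 0 = tens 1 1.
Proof. by rewrite /twF big_ord1 /rising big_ord0 !expr0 mul1r. Qed.

End TwistGrading.

(** * The proposition *)

Lemma compact_normc_bounded (R : realType) (K : set (R[i]^o)) : compact K ->
  exists2 M : R, 1 <= M & forall z, K z -> ComplexField.Normc.normc z <= M.
Proof.
have nE (z : R[i]) n : ball (0 : R[i]^o) n.+1%:R z = (ComplexField.Normc.normc z < n.+1%:R).
  rewrite /ball /= sub0r normrN -ltcR rmorph_nat; reflexivity.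
rewrite compact_cover => /(_ nat setT (fun n => ball (0 : R[i]^o) n.+1%:R)) [].
- by move=> n _; apply: ball_open; rewrite ltr0Sn.
- move=> z _; exists (Num.bound (ComplexField.Normc.normc z)) => //=.
  rewrite nE; apply: lt_trans (archi_boundP (normc_ge0 z)) _.
  by rewrite ltr_nat.
move=> D _ hD; exists (1 + \sum_(n <- D) n.+1%:R).
  by rewrite lerDl sumr_ge0.
move=> z /hD [n nD]; rewrite /= nE => /ltW/le_trans; apply.
rewrite (big_rem n) //= addrCA lerDl addr_ge0 // sumr_ge0 //.
Qed.

Lemma normc_expn_fact (R : realType) (z : R[i]) n (M : R) :
  ComplexField.Normc.normc z <= M -> ComplexField.Normc.normc (z ^+ n / n`!%:R) <= M ^+ n.
Proof.
move=> hz; have M0 : 0 <= M := le_trans (normc_ge0 z) hz.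
rewrite -lecR.
have -> x : (ComplexField.Normc.normc x)%:C%C = `|x| :> R[i] by [].
rewrite normrM normrX normfV normr_nat rmorphXn /=.
apply: (@le_trans _ _ (`|z| ^+ n)).
  by rewrite ler_piMr ?exprn_ge0 // invf_le1 ?ltr0n ?fact_gt0 // ler1n fact_gt0.
apply: lerXn2r; rewrite ?nnegrE ?normr_ge0 ?ler0c //.
by rewrite -lecR in hz.
Qed.

Theorem proposition4p5 (R : realType) (d : nat) (hd : (2 <= d)%N) (c : nat -> R[i])
    (s : R) (hs : s = 1)
    (V W X : tvsType R[i])
    (rhoV : rep (calH R d) V) (rhoW : rep (calH R d) W) (rhoX : rep (calH R d) X)
    (mu : {linear tensor V W -> X})
    (hmall : malleable rhoV rhoW rhoX mu)
    (T : inductive_triple rhoV rhoW rhoX mu) :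
  let B := @calH_ball R d in
  let F := twF d c in
  (forall (r : R) (qV : V -> R) (qW : W -> R) (K : set (R[i]^o)),
     0 < r -> cs V qV -> cs W qW -> compact K ->
     exists (qV' : V -> R) (qW' : W -> R) (t C : R),
       [/\ cs V qV', cs W qW', 0 < t & 0 < C] /\
       forall (v : V) (w : W) (hbar : R[i]) (n : nat),
         entire B rhoV s v -> entire B rhoW s w -> K hbar ->
         (ptens (entire B rhoV s) (entire B rhoW s)
                (pnorm B rhoV s r qV) (pnorm B rhoW s r qW)
                (uact2 rhoV rhoW ((hbar ^+ n / n`!%:R) *: F n) (tens v w))
          <= C%:E * pnorm B rhoV s (t * r) qV' v * pnorm B rhoW s (t * r) qW' w)%E)
  /\
  (forall (a : idx (sysV T)) (b : idx (sysW T)) (r1 r2 : R)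
     (qa : stage (sysV T) a -> R) (qb : stage (sysW T) b -> R) (K : set (R[i]^o)),
     0 < r1 -> 0 < r2 -> cs _ qa -> cs _ qb -> compact K ->
     exists (qa' : stage (sysV T) a -> R) (qb' : stage (sysW T) b -> R) (t C : R),
       [/\ cs _ qa', cs _ qb', 0 < t & 0 < C] /\
       forall (v : stage (sysV T) a) (w : stage (sysW T) b) (r : R)
              (hbar : R[i]) (n : nat),
         analytic B (resV T a) s r1 v -> analytic B (resW T b) s r2 w ->
         0 <= r -> r < 2 `^ (- s) / t * Num.min r1 r2 -> K hbar ->
         (ptens (analytic B (resV T a) s r1) (analytic B (resW T b) s r2)
                (pnorm B (resV T a) s r qa) (pnorm B (resW T b) s r qb)
                (uact2 (resV T a) (resW T b) ((hbar ^+ n / n`!%:R) *: F n) (tens v w))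
          <= C%:E * pnorm B (resV T a) s (t * r) qa' v
                  * pnorm B (resW T b) s (t * r) qb' w)%E).
Proof.
move=> B F; subst s.
have abs := @calH_ball_abs R d; have br := calH_ball_lie R d; have fin := calH_ball_fin R d.
have [M M0 hM] := abs (grading R d).
have d0 : 0 < d%:R :> R by rewrite ltr0n (leq_trans _ hd).
split=> [r qV qW K r0 hqV hqW _|a b r1 r2 qa qb K r10 r20 hqa hqb cK].
  exists qV, qW, 1, 1; split=> // v w hbar n hv hw _; rewrite !mul1r mul1e.
  have hV u : entire B rhoV 1 (uact rhoV u v) by apply: entire_uact.
  have hW u : entire B rhoW 1 (uact rhoW u w) by apply: entire_uact.
  have rge0 := ltW r0.
  have [->|n0] := posnP n.
    rewrite expr0 fact0 divr1 scale1r /F twF0 uact2_tens; try exact: rep_lie.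
    rewrite !uact1; try exact: rep_lie.
    apply: le_trans (ptens_le_sum (s := [:: tt]) (f := fun=> v) (f' := fun=> w) _ _ _ _ _) _.
    - by rewrite big_seq1.
    - by move=> _ _; rewrite -(uact1 (rep_lie rhoV) v); apply: hV.
    - by move=> _ _; rewrite -(uact1 (rep_lie rhoW) w); apply: hW.
    by rewrite big_seq1.
  apply: (@le_trans _ _ 0%E).
    (* entire vectors admit every radius: take one beyond [2 M / d] *)
    pose r' := (2 * M + 1) / d%:R.
    have r'0 : 0 < r' by rewrite divr_gt0 // addr_gt0 // mulr_gt0.
    have hk : 2 * M < n%:R * d%:R * r'.
      have -> : n%:R * d%:R * r' = n%:R * (2 * M + 1) by rewrite /r'; field; rewrite gt_eqF.
      have n1 : 1 <= n%:R :> R by rewrite ler1n.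
      nra.
    have r'1 : 0 < r' + 1 by rewrite addr_gt0.
    have [|P _ hP] := analytic_word_bound (r := r') abs (hw _ r'1) hqW.
      by rewrite ltW //= ltrDl.
    apply: (ptens_right_eigen abs _ _ _ _ hqW.1 r'0 M0 hM hk (twF_eigen c n hd)) => //.
    by exists P.
  by rewrite mule_ge0 // pnorm_ge0 //; [exact: hqV.1|exact: hqW.1].
have [C0 C01 hC0] := compact_normc_bounded cK.
have C00 : 0 <= C0 := le_trans ler01 C01.
(* from degree [N] on, the twist vanishes on vectors of radius [r2 / 2] *)
pose N := Num.bound (2 * M / (d%:R * (r2 / 2))).
pose Fs := [seq F n | n <- iota 0 N].
have [qa' [qb' [t0 [D [r0 [[hqa' hqb' t00 D0 r00] hsmall]]]]]] :=
  ptens_small_radius abs br fin (resV T a) (resW T b) Fs hqa hqb (exprn_ge0 N C00).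
have m0 : 0 < Num.min r1 r2 by rewrite lt_min r10.
(* the second summand forces [r <= r0] for the admissible radii [r] *)
pose t := t0 + Num.min r1 r2 / r0.
have tt0 : 0 < t by rewrite addr_gt0 // divr_gt0.
exists qa', qb', t, D; split=> // v w r hbar n hv hw rge0; rewrite powRN powRr1 // => hr hK.
have hV u : analytic B (resV T a) 1 r1 (uact (resV T a) u v) by apply: analytic_uact.
have hW u : analytic B (resW T b) 1 r2 (uact (resW T b) u w) by apply: analytic_uact.
have tr_lt : t * r < Num.min r1 r2.
  have : t * r < t * (2^-1 / t * Num.min r1 r2) by rewrite ltr_pM2l.
  have -> : t * (2^-1 / t * Num.min r1 r2) = Num.min r1 r2 / 2 by field; rewrite gt_eqF.
  lra.
have rr0 : r <= r0.
  have : Num.min r1 r2 / r0 * r <= Num.min r1 r2.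
    by apply: le_trans (ltW tr_lt); rewrite /t mulrDl lerDr mulr_ge0 // ltW.
  by rewrite mulrAC ler_pdivrMr // ler_pM2l.
have tr_ge0 : 0 <= t * r by rewrite mulr_ge0 // ltW.
move: tr_lt; rewrite lt_min => /andP[tr1 tr2].
have [|P eP hP] := analytic_word_bound (r := t * r) abs hv hqa'; first by rewrite tr_ge0.
have [|Q eQ hQ] := analytic_word_bound (r := t * r) abs hw hqb'; first by rewrite tr_ge0.
rewrite eP eQ -!EFinM.
have [nN|Nn] := ltnP n N.
  have t0t : 0 <= t0 * r <= t * r.
    by rewrite mulr_ge0 ?(ltW t00) //= ler_wpM2r // lerDl divr_ge0 // ltW.
  apply: hsmall => //.
  - by apply: map_f; rewrite mem_iota.
  - apply: le_trans (normc_expn_fact n (hC0 _ hK)) _.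
    by rewrite ler_weXn2l // ltnW.
  - by rewrite rge0.
  - exact: word_bound_mono hqa'.1 t0t _ hP.
  - exact: word_bound_mono hqb'.1 t0t _ hQ.
have r2h : 0 < r2 / 2 by rewrite divr_gt0.
have [|P' _ hP'] := analytic_word_bound (r := r2 / 2) abs hw hqb.
  by rewrite ltW //=; lra.
apply: (@le_trans _ _ 0%E).
  have hk : 2 * M < n%:R * d%:R * (r2 / 2).
    have dr : 0 < d%:R * (r2 / 2) by rewrite mulr_gt0.
    rewrite -mulrA -ltr_pdivrMr //; apply: lt_le_trans (archi_boundP _) _.
      by rewrite divr_ge0 ?mulr_ge0 // ltW.
    by rewrite ler_nat.
  apply: (ptens_right_eigen abs _ _ _ _ hqb.1 r2h M0 hM hk (twF_eigen c n hd)) => //.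
  by exists P'.
by rewrite lee_fin !mulr_ge0 ?(ltW D0) ?(word_bound_ge0 hqa'.1 hP) ?(word_bound_ge0 hqb'.1 hQ).
Qed.
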